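(* Consider the half-duplex bi-directional relay channel under the $(m,2)$ MABC protocol described in the context, with durations $\Delta_1,\Delta_2\ge0$, $\Delta_1+\Delta_2=1$. If $(R_a,R_b)$ is achievable, then there exist a random variable $Q$ on a finite set with $|\mathcal Q|\le 2^{m+1}$ and a joint distribution $p(q)p^{(1)}(x_a|q)p^{(1)}(x_b|q)p^{(1)}(y_{\mathcal R}|x_a,x_b)p^{(2)}(x_{\mathcal R})p^{(2)}(y_a,y_b|x_{\mathcal R})$ such that for every $S_R\subseteq\mathcal R$, with $\bar S_R=\mathcal R\setminus S_R$, $$R_a\le\Delta_1 I(X_a^{(1)};Y_{\bar S_R}^{(1)}|X_b^{(1)},Q)+\Delta_2 I(X_{S_R}^{(2)};Y_b^{(2)}|X_{\bar S_R}^{(2)}),$$ $$R_b\le\Delta_1 I(X_b^{(1)};Y_{\bar S_R}^{(1)}|X_a^{(1)},Q)+\Delta_2 I(X_{S_R}^{(2)};Y_a^{(2)}|X_{\bar S_R}^{(2)}).$$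
   Context: Network: terminals $a,b$ and relays $\mathcal R=\{r_1,\dots,r_m\}$. Each node $r$ has finite input alphabet $\mathcal X_r$ and output alphabet $\mathcal Y_r$; $\varnothing$ means no input/no output, and variables equal to $\varnothing$ are dropped from information quantities (mutual information with an empty variable set is $0$). The $(m,2)$ MABC protocol: phase 1, $a$ and $b$ transmit and all relays receive through the discrete memoryless channel $p^{(1)}(y_{\mathcal R}|x_a,x_b)$; phase 2, all relays transmit and $a,b$ receive through $p^{(2)}(y_a,y_b|x_{\mathcal R})$. $X_S^{(\ell)},Y_S^{(\ell)}$ denote inputs/outputs of the nodes in $S$ in a generic use of phase $\ell$. Messages $W_a$ (at $a$, wanted at $b$) and $W_b$ (at $b$, wanted at $a$) are independent, uniform on $\{0,\dots,\lfloor2^{nR_a}\rfloor-1\}$, $\{0,\dots,\lfloor2^{nR_b}\rfloor-1\}$. A code of length $n$ assigns $n_\ell$ channel uses to phase $\ell$; each transmitter's input at time $k$ is a function of its own message (if any) and its past outputs; $a$ decodes $\tilde W_b$ from its outputs and $W_a$, and $b$ decodes $\tilde W_a$ similarly. $(R_a,R_b)$ is achievable for durations $(\Delta_\ell)$ if there are codes with $n_\ell/n\to\Delta_\ell$ and both error probabilities $\to0$. *)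

(* Defs.v *)
From HB Require Import structures.
From mathcomp Require Import all_boot all_order all_algebra.
From mathcomp Require Import all_classical all_reals all_analysis.
Set Implicit Arguments. Unset Strict Implicit. Unset Printing Implicit Defensive.
Import Order.TTheory GRing.Theory Num.Theory.
Import numFieldNormedType.Exports.
Local Open Scope classical_set_scope.
Local Open Scope ring_scope.

Section Info.
Variable R : realType.

Definition is_pmf (T : finType) (p : T -> R) : Prop :=
  (forall t, 0 <= p t) /\ \sum_(t : T) p t = 1.

Definition log2 (x : R) : R := ln x / ln 2.

Definition prob (T : finType) (P : T -> R) (E : pred T) : R :=
  \sum_(t : T | E t) P t.

(* conditional mutual information I(X;Y|Z) in bits, for random variables
   X, Y, Z defined on the finite probability space (T, P);
   convention 0 log (..) = 0 *)
Definition cmi (T A B C : finType) (P : T -> R)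
    (X : T -> A) (Y : T -> B) (Z : T -> C) : R :=
  \sum_(a : A) \sum_(b : B) \sum_(c : C)
    let pabc := prob P (fun t => [&& X t == a, Y t == b & Z t == c]) in
    let pac := prob P (fun t => (X t == a) && (Z t == c)) in
    let pbc := prob P (fun t => (Y t == b) && (Z t == c)) in
    let pc := prob P (fun t => Z t == c) in
    if 0 < pabc then pabc * log2 (pabc * pc / (pac * pbc)) else 0.

End Info.

Section MABC.
Variables (R : realType) (m : nat) (Xa Xb Ya Yb : finType)
          (XR YR : 'I_m -> finType).

Definition relvec (F : 'I_m -> finType) := {dffun forall i : 'I_m, F i}.

(* the sub-vector (x_i)_{i in S}, encoded as a vector with None outside S *)
Definition restr (F : 'I_m -> finType) (S : {set 'I_m}) (x : relvec F)
  : {dffun forall i : 'I_m, option (F i)} :=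
  [ffun i => if i \in S then Some (x i) else None].

Definition msg_size (Rt : R) (n : nat) : nat := Num.truncn (2 `^ (Rt * n%:R)).

(* A code of length n = n1 + n2 with message sets 'I_Ma, 'I_Mb.
   Phase 1 occupies the first n1 channel uses, phase 2 the last n2.
   In phase 1 the terminals have no outputs yet, so their inputs depend on
   their messages only; relays are silent in phase 1 and in phase 2 their
   inputs are functions of their (past) phase-1 outputs. *)
Record mabc_code (Ma Mb n : nat) := MabcCode {
  n1 : nat;
  n2 : nat;
  len_eq : (n1 + n2 = n)%N;
  enc_a : 'I_Ma -> 'I_n1 -> Xa;
  enc_b : 'I_Mb -> 'I_n1 -> Xb;
  relay : forall r : 'I_m, {ffun 'I_n1 -> YR r} -> 'I_n2 -> XR r;
  dec_a : 'I_Ma -> {ffun 'I_n2 -> Ya} -> 'I_Mb;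
  dec_b : 'I_Mb -> {ffun 'I_n2 -> Yb} -> 'I_Ma
}.

Arguments n1 {Ma Mb n} _.
Arguments n2 {Ma Mb n} _.
Arguments enc_a {Ma Mb n} _ _ _.
Arguments enc_b {Ma Mb n} _ _ _.
Arguments relay {Ma Mb n} _ r _ _.
Arguments dec_a {Ma Mb n} _ _ _.
Arguments dec_b {Ma Mb n} _ _ _.

Variables (W1 : Xa -> Xb -> relvec YR -> R) (W2 : relvec XR -> Ya * Yb -> R).

Section Code.
Variables (Ma Mb n : nat) (C : mabc_code Ma Mb n).

Definition relay_inputs (y : {ffun 'I_(n1 C) -> relvec YR}) (j : 'I_(n2 C))
  : relvec XR := [ffun r => relay C r [ffun k => y k r] j].

Definition p_phase1 (wa : 'I_Ma) (wb : 'I_Mb) (y : {ffun 'I_(n1 C) -> relvec YR}) : R :=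
  \prod_(k < n1 C) W1 (enc_a C wa k) (enc_b C wb k) (y k).

Definition p_phase2 (y : {ffun 'I_(n1 C) -> relvec YR})
    (ya : {ffun 'I_(n2 C) -> Ya}) (yb : {ffun 'I_(n2 C) -> Yb}) : R :=
  \prod_(j < n2 C) W2 (relay_inputs y j) (ya j, yb j).

Definition err_a : R :=
  ((Ma * Mb)%:R)^-1 *
  \sum_(wa : 'I_Ma) \sum_(wb : 'I_Mb) \sum_(y : {ffun 'I_(n1 C) -> relvec YR})
  \sum_(ya : {ffun 'I_(n2 C) -> Ya}) \sum_(yb : {ffun 'I_(n2 C) -> Yb})
    p_phase1 wa wb y * p_phase2 y ya yb * (dec_a C wa ya != wb)%:R.

Definition err_b : R :=
  ((Ma * Mb)%:R)^-1 *
  \sum_(wa : 'I_Ma) \sum_(wb : 'I_Mb) \sum_(y : {ffun 'I_(n1 C) -> relvec YR})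
  \sum_(ya : {ffun 'I_(n2 C) -> Ya}) \sum_(yb : {ffun 'I_(n2 C) -> Yb})
    p_phase1 wa wb y * p_phase2 y ya yb * (dec_b C wb yb != wa)%:R.

End Code.

Definition achievable (D1 D2 Ra Rb : R) : Prop :=
  exists C : forall n : nat, mabc_code (msg_size Ra n) (msg_size Rb n) n,
    [/\ (fun n => (n1 (C n))%:R / n%:R : R) @ \oo --> D1,
        (fun n => (n2 (C n))%:R / n%:R : R) @ \oo --> D2,
        (fun n => err_a (C n)) @ \oo --> (0 : R) &
        (fun n => err_b (C n)) @ \oo --> (0 : R)].

Definition outer_space (K : nat) : finType :=
  ('I_K * Xa * Xb * relvec YR * relvec XR * Ya * Yb)%type.

Definition outer_pmf (K : nat) (pq : 'I_K -> R) (pa : 'I_K -> Xa -> R)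
    (pb : 'I_K -> Xb -> R) (px : relvec XR -> R) (t : outer_space K) : R :=
  let: (q, xa, xb, yR, xR, ya, yb) := t in
  pq q * pa q xa * pb q xb * W1 xa xb yR * px xR * W2 xR (ya, yb).

Definition rvQ K (t : outer_space K) : 'I_K := let: (q, _, _, _, _, _, _) := t in q.
Definition rvXa K (t : outer_space K) : Xa := let: (_, xa, _, _, _, _, _) := t in xa.
Definition rvXb K (t : outer_space K) : Xb := let: (_, _, xb, _, _, _, _) := t in xb.
Definition rvYR K (t : outer_space K) : relvec YR := let: (_, _, _, yR, _, _, _) := t in yR.
Definition rvXR K (t : outer_space K) : relvec XR := let: (_, _, _, _, xR, _, _) := t in xR.
Definition rvYa K (t : outer_space K) : Ya := let: (_, _, _, _, _, ya, _) := t in ya.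
Definition rvYb K (t : outer_space K) : Yb := let: (_, _, _, _, _, _, yb) := t in yb.

End MABC.

(* Main.v *)
(* Fix a cut S and write P for the law of (w_a, w_b, y_R, y_b) induced by a code.
   Multiplying the likelihood of P by the inverses of the ratios
   p(y_{S^c,k} | x_a,x_b) / p(y_{S^c,k} | x_b) for each use k of phase 1 and
   p(y_{b,j} | x_R) / p(y_{b,j} | x_{S^c}) for each use j of phase 2 gives a
   sub-probability under which, after summing out y_S, the pair (y_{S^c}, y_b) does
   not depend on w_a (the inputs x_{S^c} of phase 2 are functions of y_{S^c}), so b
   decodes w_a with probability at most 1/M_a.  Jensen's inequality for the
   logarithm, weighting correct decoding by M_a, then yields
     (1 - err) log M_a - 1 <= sum_k I(X_a,k; Y_{S^c},k | X_b,k) + n_2 I(X_S; Y_b | X_{S^c})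
   directly, without Fano's inequality or the chain rule; when the conditional law
   of y_b given x_{S^c} is taken from the time average p(x_R) of the relay inputs,
   phase 2 is already in single-letter form.  Conic Caratheodory reduces the phase-1
   sum to 2^(m+1) time-sharing points, and a limit along an ultrafilter on the block
   lengths, with the continuity of mutual information, concludes. *)
Require Import Defs.
From HB Require Import structures.
From mathcomp Require Import all_boot all_order all_algebra.
From mathcomp Require Import all_classical all_reals all_analysis.
From mathcomp Require Import ring lra zify.
Set Implicit Arguments. Unset Strict Implicit. Unset Printing Implicit Defensive.
Import Order.TTheory GRing.Theory Num.Theory.
Import numFieldNormedType.Exports.
Local Open Scope ring_scope.

(** * Conditional mutual information *)

Section Info.
Local Open Scope classical_set_scope.
Local Open Scope ring_scope.
Context {R : realType}.
Implicit Types T A B C D : finType.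

Lemma ln2_gt0 : 0 < ln 2 :> R.
Proof. by rewrite ln_gt0 // ltr1n. Qed.

Lemma ln_le_subr1 (x : R) : 0 < x -> ln x <= x - 1.
Proof.
move=> x0; have := @le_ln1Dx R (x - 1).
have -> : 1 + (x - 1) = x by ring.
by apply; lra.
Qed.

Lemma prob_ge0 T (P : T -> R) (E : pred T) :
  (forall t, 0 <= P t) -> 0 <= prob P E.
Proof. by move=> P0; apply: sumr_ge0. Qed.

Lemma prob_gt0 T (P : T -> R) (E : pred T) t :
  (forall t, 0 <= P t) -> E t -> 0 < P t -> 0 < prob P E.
Proof.
move=> P0 Et Pt; rewrite /prob (bigD1 t) //=.
by rewrite ltr_wpDr // sumr_ge0.
Qed.

Lemma sum_expect_law T A (P : T -> R) (V : T -> A) (F : A -> R) :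
  \sum_t P t * F (V t) = \sum_v prob P (fun t => V t == v) * F v.
Proof.
rewrite (partition_big V xpredT) //=; apply: eq_bigr => v _.
by rewrite /prob mulr_suml; apply: eq_bigr => t /eqP ->.
Qed.

Lemma prob_cond_law T A (P : T -> R) (V : T -> A) (E : pred A) :
  prob P (fun t => E (V t)) = \sum_(v | E v) prob P (fun t => V t == v).
Proof.
rewrite /prob (partition_big V E) //=; apply: eq_bigr => v Ev.
by apply: eq_bigl => t; case: eqP => [->|]; rewrite ?Ev ?andbF.
Qed.

(** The information is the mean of its density at the sample points: cells of mass zero contribute
    nothing on either side, which absorbs the [0 log] convention. *)
Lemma cmi_expect T A B C (P : T -> R) (X : T -> A) (Y : T -> B) (Z : T -> C) :
  (forall t, 0 <= P t) ->
  cmi P X Y Z = \sum_t P t * log2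
    (prob P (fun s => [&& X s == X t, Y s == Y t & Z s == Z t]) *
     prob P (fun s => Z s == Z t) /
    (prob P (fun s => (X s == X t) && (Z s == Z t)) *
     prob P (fun s => (Y s == Y t) && (Z s == Z t)))).
Proof.
move=> P0; pose F (v : A * B * C) := log2
    (prob P (fun s => [&& X s == v.1.1, Y s == v.1.2 & Z s == v.2]) *
     prob P (fun s => Z s == v.2) /
    (prob P (fun s => (X s == v.1.1) && (Z s == v.2)) *
     prob P (fun s => (Y s == v.1.2) && (Z s == v.2)))).
rewrite -[RHS]/(\sum_t P t * F (X t, Y t, Z t)).
rewrite (sum_expect_law P (fun t => (X t, Y t, Z t)) F).
rewrite /cmi pair_bigA /= pair_bigA /=.
apply: eq_bigr => -[[a b] c] _ /=.
have E : prob P (fun t => (X t, Y t, Z t) == (a, b, c)) =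
  prob P (fun t => [&& X t == a, Y t == b & Z t == c]).
  by apply: eq_bigl => t; rewrite !xpair_eqE andbA.
rewrite E /F /=; case: ifPn => //.
rewrite -leNgt => le0.
have -> : prob P (fun t => [&& X t == a, Y t == b & Z t == c]) = 0.
  by apply/eqP; rewrite eq_le le0 prob_ge0.
by rewrite mul0r.
Qed.

(** Common form of both phases: [r] is the law of [X] and [Y] is its output through the kernel [K].
    As [f] and [g] together determine the input, the information is the mean divergence of [K x]
    from the output law given [g X]. *)
Lemma cmi_channel T A B C D (P : T -> R) (X : T -> D) (Y : T -> B)
    (f : D -> A) (g : D -> C) (r : D -> R) (K : D -> B -> R) :
  (forall t, 0 <= P t) ->
  (forall x x', f x = f x' -> g x = g x' -> x = x') ->
  (forall x, \sum_b K x b = 1) ->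
  (forall x b, prob P (fun t => (X t == x) && (Y t == b)) = r x * K x b) ->
  cmi P (f \o X) Y (g \o X) = \sum_x r x * \sum_b K x b *
    log2 (K x b / ((\sum_(x' | g x' == g x) r x' * K x' b) /
                   (\sum_(x' | g x' == g x) r x'))).
Proof.
move=> P0 fg K1 J; rewrite cmi_expect //.
have pX x : prob P (fun t => X t == x) = r x.
  rewrite -[RHS]mulr1 -(K1 x) mulr_sumr /prob (partition_big Y xpredT) //=.
  by apply: eq_bigr => b _; rewrite -J.
pose F (v : D * B) := log2 (r v.1 * K v.1 v.2 * (\sum_(x' | g x' == g v.1) r x') /
    (r v.1 * (\sum_(x' | g x' == g v.1) r x' * K x' v.2))).
transitivity (\sum_t P t * F (X t, Y t)).
  apply: eq_bigr => t _; congr (_ * log2 _); rewrite /=.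
  congr (_ * _ / (_ * _)).
  - rewrite -J; apply: eq_bigl => s /=; apply/and3P/andP.
      by case=> /eqP e1 -> /eqP e2; rewrite (fg _ _ e1 e2) eqxx.
    by case=> /eqP -> ->; rewrite !eqxx.
  - rewrite (prob_cond_law P X (fun x => g x == g (X t))).
    by apply: eq_bigr => x _; rewrite pX.
  - rewrite -pX; apply: eq_bigl => s /=; apply/andP/eqP.
      by case=> /eqP e1 /eqP e2; apply: fg.
    by move=> ->; rewrite !eqxx.
  - rewrite (prob_cond_law P (fun s => (X s, Y s))
      (fun v => (v.2 == Y t) && (g v.1 == g (X t)))).
    rewrite (partition_big fst (fun x => g x == g (X t))) /=; last by case=> ? ? /andP[].
    apply: eq_bigr => x gx; rewrite (big_pred1 (x, Y t)) => [|[x' b]].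
      by rewrite -J; apply: eq_bigl => s; rewrite xpair_eqE.
    rewrite /= xpair_eqE; case: (x' =P x) => [->|]; last by rewrite andbF.
    by rewrite gx !andbT.
rewrite sum_expect_law -(pair_bigA _ (fun x b =>
  prob P (fun t => (X t, Y t) == (x, b)) * F (x, b))) /=.
apply: eq_bigr => x _; rewrite mulr_sumr; apply: eq_bigr => b _.
rewrite (_ : prob P _ = r x * K x b); last first.
  by rewrite -J; apply: eq_bigl => s; rewrite xpair_eqE.
rewrite -mulrA /F /=.
(* Inputs of mass zero drop out; otherwise [r x] cancels inside the logarithm. *)
have [->|rx0] := eqVneq (r x) 0; first by rewrite !mul0r.
congr (_ * (_ * log2 _)).
by rewrite invf_div mulrA -[r x * _ * _]mulrA -mulf_div divff // mul1r.
Qed.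

Definition xlnx (x : R) : R := x * ln x.

(** The identity I = H(X,Z) + H(Y,Z) - H(X,Y,Z) - H(Z). Free of quotients, it is continuous in [P]
    even where probabilities vanish. *)
Lemma cmi_entropy T A B C (P : T -> R) (X : T -> A) (Y : T -> B) (Z : T -> C) :
  (forall t, 0 <= P t) ->
  cmi P X Y Z = (ln 2)^-1 *
    (\sum_v xlnx (prob P (fun s => ((X s, Y s), Z s) == v)) +
     \sum_v xlnx (prob P (fun s => Z s == v)) -
     \sum_v xlnx (prob P (fun s => (X s, Z s) == v)) -
     \sum_v xlnx (prob P (fun s => (Y s, Z s) == v))).
Proof.
move=> P0; rewrite cmi_expect //.
have E D (V : T -> D) : \sum_v xlnx (prob P (fun s => V s == v)) =
    \sum_t P t * ln (prob P (fun s => V s == V t)).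
  by rewrite (sum_expect_law P V (fun v => ln (prob P (fun s => V s == v)))).
rewrite !E -big_split /= -!sumrB mulr_sumr; apply: eq_bigr => t _.
have [->|Pt0] := eqVneq (P t) 0; first by rewrite !mul0r; ring.
have Pt : 0 < P t by rewrite lt_def Pt0 P0.
have G (e : pred T) : e t -> prob P e \is Num.pos.
  by move=> et; rewrite posrE; apply: prob_gt0 Pt.
rewrite /log2 ln_div ?lnM ?rpredM ?G ?eqxx //=.
have e3 : prob P (fun s => (X s, Y s, Z s) == (X t, Y t, Z t)) =
  prob P (fun s => [&& X s == X t, Y s == Y t & Z s == Z t]).
  by apply: eq_bigl => s; rewrite !xpair_eqE andbA.
by rewrite e3; ring.
Qed.

Lemma cvg_xlnx I (F : set_system I) (FF : ProperFilter F) (u : I -> R) (l : R) :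
  (forall i, 0 <= u i) -> u @ F --> l -> (fun i => xlnx (u i)) @ F --> xlnx l.
Proof.
move=> u0 ul.
have l0 : 0 <= l.
  apply: (cvgr_to_ge ul).
  by apply: nearW => i; apply: u0.
have [l_eq0|ln0] := eqVneq l 0; last first.
  apply: cvgM => //; apply: continuous_cvg => //; apply: continuous_ln.
  by rewrite lt_def ln0.
rewrite l_eq0 in ul *; rewrite /xlnx mul0r.
(* The lower bound is [ln y >= 1 - 1 / y] at [y = sqrt x]. *)
apply: (@squeeze_cvgr I F _ R (fun i => u i * 2 - 2 * Num.sqrt (u i))
   (fun i => u i * (u i - 1))).
- apply: nearW => i; have := u0 i; set x := u i.
  rewrite le_eqVlt => /orP[/eqP <-|x0]; first by rewrite sqrtr0; apply/andP; split; lra.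
  have s0 : 0 < Num.sqrt x by rewrite sqrtr_gt0.
  apply/andP; split; last by rewrite ler_pM2l // ln_le_subr1.
  have xs : x = Num.sqrt x ^+ 2 by rewrite sqr_sqrtr // ltW.
  have := @ln_le_subr1 (Num.sqrt x)^-1; rewrite invr_gt0 s0 => /(_ isT).
  rewrite lnV ?posrE // => H.
  rewrite {3 4}xs lnXn // -xs.
  have : x * - ln (Num.sqrt x) <= x * ((Num.sqrt x)^-1 - 1) by rewrite ler_pM2l.
  have -> : x * ((Num.sqrt x)^-1 - 1) = Num.sqrt x - x.
    by rewrite mulrBr mulr1 {1}xs expr2 mulfK // gt_eqF.
  by rewrite mulr2n; lra.
- rewrite [X in _ --> X](_ : 0 = 0 * 2 - 2 * Num.sqrt 0); last by rewrite sqrtr0; ring.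
  apply: cvgB; first by apply: cvgM => //; exact: cvg_cst.
  apply: cvgM; first exact: cvg_cst.
  apply: (continuous_cvg _ _ ul).
  exact: sqrt_continuous.
- rewrite [X in _ --> X](_ : 0 = 0 * (0 - 1)); last by rewrite mul0r.
  by apply: cvgM => //; apply: cvgB => //; exact: cvg_cst.
Qed.

Lemma cvg_sumr I (F : set_system I) (FF : Filter F) (J : Type) (r : seq J)
    (p : pred J) (u : J -> I -> R) (l : J -> R) :
  (forall j, p j -> u j @ F --> l j) ->
  (fun i => \sum_(j <- r | p j) u j i) @ F --> \sum_(j <- r | p j) l j.
Proof. by move=> ul; apply: cvg_big => //; exact: add_continuous. Qed.

Lemma cmi_cvg I (F : set_system I) (FF : ProperFilter F) T A B C
    (P : I -> T -> R) (P' : T -> R) (X : T -> A) (Y : T -> B) (Z : T -> C) :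
  (forall i t, 0 <= P i t) -> (forall t, (fun i => P i t) @ F --> P' t) ->
  (fun i => cmi (P i) X Y Z) @ F --> cmi P' X Y Z.
Proof.
move=> P0 PP.
have P'0 t : 0 <= P' t.
  apply: (cvgr_to_ge (PP t)).
  by apply: nearW => i; apply: P0.
have pc (E : pred T) : (fun i => prob (P i) E) @ F --> prob P' E.
  by apply: cvg_sumr => t _; apply: PP.
rewrite cmi_entropy //.
under eq_fun do rewrite cmi_entropy //.
have xc D (V : T -> D) : (fun i => \sum_v xlnx (prob (P i) (fun s => V s == v))) @ F -->
   \sum_v xlnx (prob P' (fun s => V s == v)).
  by apply: cvg_sumr => v _; apply: cvg_xlnx => // i; apply: prob_ge0.
apply: cvgM; first exact: cvg_cst.
by apply: cvgB; [apply: cvgB; [apply: cvgD|]|]; apply: xc.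
Qed.

End Info.

(** * Conic Caratheodory theorem *)

Section Caratheodory.
Context {R : realFieldType}.

(** With more vectors than coordinates the left kernel is nonzero; changing the sign of a kernel
    vector if necessary makes some coefficient positive. *)
Lemma dependent_family (J : finType) N (g : J -> 'I_N -> R) :
  (#|J| < N)%N ->
  exists l : 'I_N -> R, (exists i, 0 < l i) /\ forall j, \sum_i l i * g j i = 0.
Proof.
move=> JN; pose A : 'M[R]_(N, #|J|) := \matrix_(i, j) g (enum_val j) i.
have /rowV0Pn[v /sub_kermxP vA v0] : kermx A != 0.
  rewrite -mxrank_eq0 mxrank_ker subn_eq0 -ltnNge.
  exact: leq_ltn_trans (rank_leq_col A) JN.
have vg j : \sum_i v 0 i * g j i = 0.
  have := congr1 (fun M : 'rV_ _ => M 0 (enum_rank j)) vA.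
  rewrite !mxE => E; rewrite -[RHS]E.
  by apply: eq_bigr => i _; rewrite !mxE enum_rankK.
have [i vi0] : exists i, v 0 i != 0.
  apply/existsP; apply: contraR v0; rewrite negb_exists => /forallP v0.
  by apply/eqP/rowP => i; rewrite mxE; apply/eqP/negbNE/v0.
have [vi|vi] := ltP 0 (v 0 i); first by exists (v 0); split=> //; exists i.
exists (fun i => - v 0 i); split; first by exists i; rewrite oppr_gt0 lt_def vi eq_sym vi0.
by move=> j; under eq_bigr do rewrite mulNr; rewrite sumrN vg oppr0.
Qed.

(** Descent on the number of points: subtract a multiple of a linear relation until one weight
    vanishes, then drop that point. Once at most [K] points remain, zero weights pad the family to
    size [K]. *)
Lemma conic_caratheodory (J : finType) K N (g : J -> 'I_N -> R) (w : 'I_N -> R) :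
  (#|J| <= K)%N -> (0 < N)%N -> (forall i, 0 <= w i) ->
  exists (s : 'I_K -> 'I_N) (v : 'I_K -> R), (forall k, 0 <= v k) /\
    forall j, \sum_k v k * g j (s k) = \sum_i w i * g j i.
Proof.
move=> JK; elim: N g w => // N IH g w _ w0.
have [NK|KN] := leqP N.+1 K.
  exists (fun k => inord k), (fun k => if (k < N.+1)%N then w (inord k) else 0).
  split=> [k|j]; first by case: ifP.
  pose h n := w (inord n) * g j (inord n).
  rewrite (eq_bigr (fun i : 'I_N.+1 => h i)); last by move=> i _; rewrite /h inord_val.
  rewrite (big_ord_widen _ h NK) [RHS]big_mkcond /=.
  by apply: eq_bigr => k _; case: ifP => // _; rewrite mul0r.
(* A single point exceeding [K] forces [K = 0], hence [J] is empty and no equation remains. *)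
have [N0|N0] := posnP N.
  exists (fun=> ord0), (fun=> 0); split=> // j.
  by have := leq_trans (max_card (pred1 j)) JK; rewrite card1; lia.
have [l [[i1 li1] lg]] := dependent_family g (leq_ltn_trans JK KN).
have [i0 li0 mini0] := @arg_minP _ _ _ i1 (fun i => 0 < l i) (fun i => w i / l i) li1.
(* The largest multiple of the relation that keeps all weights nonnegative; it cancels the weight at
   [i0]. *)
pose t := w i0 / l i0.
have t0 : 0 <= t by rewrite divr_ge0 // ltW.
pose w' i := w i - t * l i.
have w'0 i : 0 <= w' i.
  rewrite subr_ge0; have [li|li] := ltP 0 (l i); first by rewrite -ler_pdivlMr ?mini0.
  by apply: le_trans (w0 i); rewrite mulr_ge0_le0.
have w'i0 : w' i0 = 0 by rewrite /w' /t mulfVK ?subrr ?gt_eqF.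
have [s [v [v0 vE]]] := IH (fun j i => g j (lift i0 i)) (fun i => w' (lift i0 i)) N0
  (fun i => w'0 _).
exists (fun k => lift i0 (s k)), v; split=> // j.
rewrite vE; transitivity (\sum_i w' i * g j i).
  by rewrite (bigD1_ord i0) //= w'i0 mul0r add0r.
under eq_bigr do rewrite mulrBl -mulrA.
by rewrite sumrB -mulr_sumr lg mulr0 subr0.
Qed.

End Caratheodory.

(** * Change-of-measure converse *)

Section Sums.
Context {R : realType}.

(** Jensen's inequality through the tangent of [ln] at [c]: [ln x <= ln c + x / c - 1]. *)
Lemma sum_ln_le (T : finType) (P L : T -> R) (c : R) :
  (forall t, 0 <= P t) -> \sum_t P t = 1 -> (forall t, 0 < P t -> 0 < L t) ->
  0 < c -> \sum_t P t * L t <= c -> \sum_t P t * ln (L t) <= ln c.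
Proof.
move=> P0 P1 L0 c0 PL.
have H t : P t * ln (L t) <= P t * ln c + c^-1 * (P t * L t) - P t.
  have [->|Pt0] := eqVneq (P t) 0; first by rewrite !mul0r mulr0; lra.
  have Pt : 0 < P t by rewrite lt_def Pt0 P0.
  have Lt := L0 t Pt.
  have -> : P t * ln c + c^-1 * (P t * L t) - P t = P t * (ln c + (L t / c - 1)) by ring.
  rewrite ler_pM2l // -lerBlDl -ln_div ?posrE //.
  by apply: ln_le_subr1; rewrite divr_gt0.
apply: le_trans (ler_sum _ (fun t _ => H t)) _.
rewrite sumrB big_split /= -mulr_suml -mulr_sumr P1 mul1r.
suff : c^-1 * (\sum_t P t * L t) <= 1 by lra.
by rewrite ler_pdivrMl // mulr1.
Qed.

Lemma sum_pair (I J : finType) (G : I * J -> R) : \sum_p G p = \sum_i \sum_j G (i, j).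
Proof. by rewrite pair_bigA; apply: eq_bigr => -[]. Qed.

Lemma sum_ffun_prod_family (I J : finType) (U : eqType) (phi : J -> U) (u : I -> U)
    (p : I -> J -> R) :
  \sum_(f : {ffun I -> J} | [forall i, phi (f i) == u i]) \prod_i p i (f i) =
  \prod_i \sum_(j | phi j == u i) p i j.
Proof.
rewrite (bigA_distr_big_dep (fun i j => phi j == u i)).
by apply: eq_bigl => f; apply/forallP/familyP.
Qed.

(** Absorbing [g] into the factor [i] keeps the summand a product, whose other factors sum to 1. *)
Lemma sum_ffun_prod_proj (I J : finType) (p : I -> J -> R) (g : J -> R) i :
  (forall k, \sum_j p k j = 1) ->
  \sum_(f : {ffun I -> J}) (\prod_k p k (f k)) * g (f i) = \sum_j p i j * g j.
Proof.
move=> p1; pose q k j := p k j * (if k == i then g j else 1).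
rewrite (eq_bigr (fun f : {ffun I -> J} => \prod_k q k (f k))); last first.
  move=> f _; rewrite /q big_split /=; congr (_ * _).
  by rewrite -big_mkcond /= big_pred1_eq.
rewrite -(bigA_distr_bigA q) (bigD1 i) //= /q eqxx [X in _ * X]big1 ?mulr1 // => k ki.
by rewrite -[RHS](p1 k) (negPf ki); apply: eq_bigr => j _; rewrite mulr1.
Qed.

Lemma sum_ffun_prod1 (I J : finType) (p : I -> J -> R) :
  (forall k, \sum_j p k j = 1) -> \sum_(f : {ffun I -> J}) \prod_k p k (f k) = 1.
Proof. by move=> p1; rewrite -(bigA_distr_bigA p) big1. Qed.

(** Law of the symbol [e w] for a uniform message [w]. *)
Definition empirical (T : finType) M (e : 'I_M -> T) (x : T) : R :=
  M%:R^-1 * \sum_w (e w == x)%:R.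

Lemma sum_delta (T : finType) (a : T) (F : T -> R) : \sum_x (a == x)%:R * F x = F a.
Proof.
by rewrite (bigD1 a) //= eqxx mul1r big1 ?addr0 // => x; rewrite eq_sym => /negPf ->; rewrite mul0r.
Qed.

Lemma sum_empirical (T : finType) M (e : 'I_M -> T) (F : T -> R) :
  \sum_x empirical e x * F x = M%:R^-1 * \sum_w F (e w).
Proof.
rewrite /empirical; under eq_bigr do rewrite -mulrA mulr_suml.
rewrite -mulr_sumr exchange_big /=; congr (_ * _).
by apply: eq_bigr => w _; rewrite sum_delta.
Qed.

Lemma empirical_ge0 (T : finType) M (e : 'I_M -> T) x : 0 <= empirical e x.
Proof. by rewrite mulr_ge0 ?invr_ge0 // sumr_ge0. Qed.

Lemma empirical_gt0 (T : finType) M (e : 'I_M -> T) w : 0 < empirical e (e w).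
Proof.
rewrite mulr_gt0 ?invr_gt0 ?ltr0n ?(leq_trans _ (ltn_ord w)) //.
by rewrite (bigD1 w) //= eqxx ltr_pwDl // sumr_ge0.
Qed.

Lemma empirical_pmf (T : finType) M (e : 'I_M -> T) : (0 < M)%N -> is_pmf (empirical e).
Proof.
move=> M0; split=> [x|]; first exact: empirical_ge0.
have := sum_empirical e (fun=> 1); under eq_bigr do rewrite mulr1.
by move=> ->; rewrite sumr_const card_ord mulVf // pnatr_eq0 -lt0n.
Qed.

End Sums.

(** * Phase-1 information carried by an observation of the relay outputs *)

Section Phase1Info.
Context {R : realType} (Xa Xb Yr U : finType).
Variables (W : Xa -> Xb -> Yr -> R) (phi : Yr -> U).
Hypothesis HW : forall xa xb, is_pmf (W xa xb).

Definition obs_law (xa : Xa) (xb : Xb) (u : U) : R := \sum_(y | phi y == u) W xa xb y.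

(** Law of the observation given [x_b] alone, with [x_a] drawn from [pa]. *)
Definition obs_given_b (pa : Xa -> R) (xb : Xb) (u : U) : R := \sum_xa pa xa * obs_law xa xb u.

(* [ln 2 * I(X_a; phi(Y_R) | X_b)] for independent inputs; [phi] selects [Y_{S^c}]. *)
Definition phase1_info (pa : Xa -> R) (pb : Xb -> R) : R :=
  \sum_xa pa xa * \sum_xb pb xb *
    \sum_u obs_law xa xb u * ln (obs_law xa xb u / obs_given_b pa xb u).

Lemma channel_ge0 xa xb y : 0 <= W xa xb y.
Proof. by have [] := HW xa xb. Qed.

Lemma sum_obs xa xb (F : U -> R) :
  \sum_u obs_law xa xb u * F u = \sum_y W xa xb y * F (phi y).
Proof.
rewrite [RHS](partition_big phi xpredT) //=; apply: eq_bigr => u _.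
by rewrite mulr_suml; apply: eq_bigr => y /eqP ->.
Qed.

Lemma obs_pmf xa xb : is_pmf (obs_law xa xb).
Proof.
split=> [u|]; first by apply: sumr_ge0 => y _; apply: channel_ge0.
have := sum_obs xa xb (fun=> 1).
under eq_bigr do rewrite mulr1; under [in RHS]eq_bigr do rewrite mulr1.
by move=> ->; have [] := HW xa xb.
Qed.

Lemma obs_gt0 xa xb y : 0 < W xa xb y -> 0 < obs_law xa xb (phi y).
Proof.
move=> Wy; rewrite /obs_law (bigD1 y) //= ltr_wpDr // sumr_ge0 // => ? _; exact: channel_ge0.
Qed.

Lemma obs_avg_pmf pa xb : is_pmf pa -> is_pmf (obs_given_b pa xb).
Proof.
move=> [pa0 pa1]; split=> [u|].
  by apply: sumr_ge0 => xa _; rewrite mulr_ge0 //; have [] := obs_pmf xa xb.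
rewrite exchange_big /= -[RHS]pa1; apply: eq_bigr => xa _.
by rewrite -mulr_sumr; have [_ ->] := obs_pmf xa xb; rewrite mulr1.
Qed.

Lemma obs_avg_gt0 (pa : Xa -> R) xa xb u :
  (forall x, 0 <= pa x) -> 0 < pa xa -> 0 < obs_law xa xb u -> 0 < obs_given_b pa xb u.
Proof.
move=> pa0 px Ku; rewrite /obs_given_b (bigD1 xa) //= ltr_pwDl ?mulr_gt0 // sumr_ge0 // => x _.
by rewrite mulr_ge0 //; have [] := obs_pmf x xb.
Qed.

End Phase1Info.

(** * Phase-2 information across a cut *)

Section Phase2Info.
Context {R : realType} (XX Yo U2 : finType).
Variables (V : XX -> Yo -> R) (psi : XX -> U2).
Hypothesis HV : forall x, is_pmf (V x).

(* The law of the output given [X_{S^c} = c]; it is [0] when [c] has probability [0]. *)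
Definition out_given_cut (px : XX -> R) (c : U2) (z : Yo) : R :=
  (\sum_(x | psi x == c) px x * V x z) / (\sum_(x | psi x == c) px x).

(* [ln 2 * I(X_S; Y | X_{S^c})], where [psi] selects [X_{S^c}] from [X_R]. *)
Definition phase2_info (px : XX -> R) : R :=
  \sum_x px x * \sum_z V x z * ln (V x z / out_given_cut px (psi x) z).

Lemma out_avg_ge0 px c z : (forall x, 0 <= px x) -> 0 <= out_given_cut px c z.
Proof.
move=> px0; rewrite divr_ge0 ?sumr_ge0 // => x _.
by rewrite mulr_ge0 //; have [] := HV x.
Qed.

(** Only an inequality, since the sum is 0 at a value [c] of probability zero. *)
Lemma sum_out_avg_le1 px c : (forall x, 0 <= px x) -> \sum_z out_given_cut px c z <= 1.
Proof.
move=> px0; rewrite -mulr_suml exchange_big /=.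
rewrite (eq_bigr px) => [|x _]; last first.
  by rewrite -mulr_sumr; have [_ ->] := HV x; rewrite mulr1.
set s := \sum_(x | _) _; have [->|s0] := eqVneq s 0; first by rewrite mul0r.
by rewrite divff.
Qed.

Lemma out_avg_gt0 (px : XX -> R) x z : (forall x, 0 <= px x) ->
  0 < px x -> 0 < V x z -> 0 < out_given_cut px (psi x) z.
Proof.
move=> px0 pxx Vx; rewrite divr_gt0 // (bigD1 x) //= ltr_pwDl ?mulr_gt0 // sumr_ge0 // => x' _.
by rewrite mulr_ge0 //; have [] := HV x'.
Qed.

End Phase2Info.

(** * Converse for one cut and one sink *)

Section Converse.
Context {R : realType} (Xa Xb Yr XX Yo U U2 : finType).
Variables (W : Xa -> Xb -> Yr -> R) (V : XX -> Yo -> R) (phi : Yr -> U) (psi : XX -> U2).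
Hypothesis HW : forall xa xb, is_pmf (W xa xb).
Hypothesis HV : forall x, is_pmf (V x).
Variables (Ma Mb n1 n2 : nat) (ea : 'I_Ma -> 'I_n1 -> Xa) (eb : 'I_Mb -> 'I_n1 -> Xb)
  (rel : {ffun 'I_n1 -> Yr} -> 'I_n2 -> XX) (dec : 'I_Mb -> {ffun 'I_n2 -> Yo} -> 'I_Ma)
  (xi : {ffun 'I_n1 -> U} -> 'I_n2 -> U2).
Hypotheses (Ma0 : (0 < Ma)%N) (Mb0 : (0 < Mb)%N).
(* The relays on the sink side of the cut see only the outputs selected by [phi]. *)
Hypothesis rel_xi : forall y j, psi (rel y j) = xi [ffun k => phi (y k)] j.

Let ph1 wa wb (y : {ffun 'I_n1 -> Yr}) : R := \prod_k W (ea wa k) (eb wb k) (y k).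
Let ph2 y (z : {ffun 'I_n2 -> Yo}) : R := \prod_j V (rel y j) (z j).
Let pea k : Xa -> R := empirical (fun w => ea w k).
Let peb k : Xb -> R := empirical (fun w => eb w k).
Variable px : XX -> R.
Hypothesis px0 : forall x, 0 <= px x.
(** [px] is the time average of the laws of the relay inputs; in product form the condition also
    makes sense for [n2 = 0]. *)
Hypothesis px_usage : forall x, n2%:R * px x =
  \sum_j (Ma * Mb)%:R^-1 * \sum_wa \sum_wb \sum_y ph1 wa wb y * (rel y j == x)%:R.

Let Om : finType := ('I_Ma * ('I_Mb * ({ffun 'I_n1 -> Yr} * {ffun 'I_n2 -> Yo})))%type.
Let P (t : Om) : R :=
  (Ma * Mb)%:R^-1 * (ph1 t.1 t.2.1 t.2.2.1 * ph2 t.2.2.1 t.2.2.2).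

Let c0 : 0 < (Ma * Mb)%:R^-1 :> R.
Proof. by rewrite invr_gt0 ltr0n muln_gt0 Ma0. Qed.

Let ph1_ge0 wa wb y : 0 <= ph1 wa wb y.
Proof. by apply: prodr_ge0 => k _; apply: (channel_ge0 HW). Qed.

Let ph2_ge0 y z : 0 <= ph2 y z.
Proof. by apply: prodr_ge0 => k _; have [] := HV (rel y k). Qed.

Let sum_ph1 wa wb : \sum_y ph1 wa wb y = 1.
Proof.
apply: (@sum_ffun_prod1 R _ _ (fun k => W (ea wa k) (eb wb k))) => k.
by have [] := HW (ea wa k) (eb wb k).
Qed.

Let sum_ph2 y : \sum_z ph2 y z = 1.
Proof.
apply: (@sum_ffun_prod1 R _ _ (fun k => V (rel y k))) => k.
by have [] := HV (rel y k).
Qed.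

Let sum_P F : \sum_t P t * F t = (Ma * Mb)%:R^-1 *
  \sum_wa \sum_wb \sum_y ph1 wa wb y * \sum_z ph2 y z * F (wa, (wb, (y, z))).
Proof.
rewrite sum_pair mulr_sumr; apply: eq_bigr => wa _.
rewrite sum_pair mulr_sumr; apply: eq_bigr => wb _.
rewrite sum_pair mulr_sumr; apply: eq_bigr => y _.
rewrite mulrA mulr_sumr; apply: eq_bigr => z _.
by rewrite /P /=; ring.
Qed.

Let sum_P1 (F : 'I_Ma -> 'I_Mb -> {ffun 'I_n1 -> Yr} -> R) :
  \sum_t P t * F t.1 t.2.1 t.2.2.1 = (Ma * Mb)%:R^-1 *
  \sum_wa \sum_wb \sum_y ph1 wa wb y * F wa wb y.
Proof.
rewrite (sum_P (fun t => F t.1 t.2.1 t.2.2.1)) /=; congr (_ * _).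
apply: eq_bigr => wa _; apply: eq_bigr => wb _; apply: eq_bigr => y _.
by rewrite -mulr_suml sum_ph2 mul1r.
Qed.

(** The logarithms of [l1] and [l2] are the information densities of single uses of phases 1 and
    2. *)
Let l1 (t : Om) k : R := obs_law W phi (ea t.1 k) (eb t.2.1 k) (phi (t.2.2.1 k)) /
   obs_given_b W phi (pea k) (eb t.2.1 k) (phi (t.2.2.1 k)).
Let l2 (t : Om) j : R := V (rel t.2.2.1 j) (t.2.2.2 j) /
   out_given_cut V psi px (psi (rel t.2.2.1 j)) (t.2.2.2 j).

(** Uniform independent messages give independent inputs with laws [pea k] and [peb k]; the other
    uses of phase 1 and all of phase 2 sum out. *)
Let sum_l1 k : \sum_t P t * ln (l1 t k) = phase1_info W phi (pea k) (peb k).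
Proof.
pose F xa xb y := ln (obs_law W phi xa xb (phi y) / obs_given_b W phi (pea k) xb (phi y)).
rewrite (sum_P1 (fun wa wb y => F (ea wa k) (eb wb k) (y k))).
pose D xa xb := \sum_u obs_law W phi xa xb u *
  ln (obs_law W phi xa xb u / obs_given_b W phi (pea k) xb u).
rewrite /phase1_info (sum_empirical _ (fun xa => \sum_xb peb k xb * D xa xb)).
rewrite natrM invfM -mulrA; congr (_ * _); rewrite mulr_sumr; apply: eq_bigr => wa _.
rewrite sum_empirical; congr (_ * _); apply: eq_bigr => wb _.
rewrite /D (sum_obs _ _ _ _
  (fun u => ln (obs_law W phi (ea wa k) (eb wb k) u / obs_given_b W phi (pea k) (eb wb k) u))).
rewrite (sum_ffun_prod_proj (p := fun k => W (ea wa k) (eb wb k)) (F (ea wa k) (eb wb k))) //.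
by move=> k'; have [] := HW (ea wa k') (eb wb k').
Qed.

(** The reference law is the same for every use, so the mean depends only on the expected number of
    uses of each input [x], which is [n2 * px x]. *)
Let sum_l2 : \sum_t P t * \sum_j ln (l2 t j) = n2%:R * phase2_info V psi px.
Proof.
pose D x := \sum_z V x z * ln (V x z / out_given_cut V psi px (psi x) z).
rewrite sum_P /phase2_info mulr_sumr.
transitivity ((Ma * Mb)%:R^-1 * \sum_wa \sum_wb \sum_y ph1 wa wb y * \sum_j D (rel y j)).
  congr (_ * _); apply: eq_bigr => wa _; apply: eq_bigr => wb _; apply: eq_bigr => y _.
  congr (_ * _).
  under eq_bigr do rewrite mulr_sumr.
  rewrite exchange_big /=; apply: eq_bigr => j _.
  pose G z := ln (V (rel y j) z / out_given_cut V psi px (psi (rel y j)) z).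
  rewrite (sum_ffun_prod_proj (p := fun k => V (rel y k)) G) //.
  by move=> k'; have [] := HV (rel y k').
rewrite -(sum_P1 (fun wa wb y => \sum_j D (rel y j))).
have usage x : n2%:R * px x = \sum_j \sum_t P t * (rel t.2.2.1 j == x)%:R.
  rewrite px_usage; apply: eq_bigr => j _.
  by rewrite (sum_P1 (fun wa wb y => (rel y j == x)%:R)).
under [RHS]eq_bigr do rewrite mulrA usage mulr_suml.
rewrite exchange_big /=; under eq_bigr do rewrite mulr_sumr.
rewrite exchange_big /=; apply: eq_bigr => j _.
under [RHS]eq_bigr do rewrite mulr_suml.
rewrite exchange_big /=; apply: eq_bigr => t _.
under [RHS]eq_bigr do rewrite -mulrA.
by rewrite -mulr_sumr sum_delta.
Qed.

Let ok (t : Om) := dec t.2.1 t.2.2.2 == t.1.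
Let gain (t : Om) : R := if ok t then Ma%:R else 1.
(* A ratio [l1] or [l2] that vanishes has inverse [0], which only decreases [P * lik]. *)
Let lik (t : Om) : R := (\prod_k (l1 t k)^-1) * (\prod_j (l2 t j)^-1) * gain t.

Let Pgt0 t : 0 < P t ->
  (forall k, 0 < W (ea t.1 k) (eb t.2.1 k) (t.2.2.1 k)) /\
  (forall j, 0 < V (rel t.2.2.1 j) (t.2.2.2 j)).
Proof.
rewrite pmulr_rgt0 // => H.
have : ph1 t.1 t.2.1 t.2.2.1 != 0 /\ ph2 t.2.2.1 t.2.2.2 != 0.
  by apply/andP; rewrite -negb_or -mulf_eq0 gt_eqF.
case; rewrite /ph1 /ph2 !prodf_seq_neq0 => /allP h1 /allP h2; split=> k.
  by rewrite lt_def (channel_ge0 HW) andbT; apply: h1; rewrite mem_index_enum.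
rewrite lt_def; have [-> _] := HV (rel t.2.2.1 k).
by rewrite andbT; apply: h2; rewrite mem_index_enum.
Qed.

Let l1_gt0 t k : 0 < P t -> 0 < l1 t k.
Proof.
move=> /Pgt0[Wt _]; have Kt := obs_gt0 phi HW (Wt k).
rewrite divr_gt0 //; apply: (obs_avg_gt0 HW _ _ Kt); first exact: empirical_ge0.
exact: (empirical_gt0 (fun w => ea w k)).
Qed.

Let l2_gt0 t j : 0 < P t -> 0 < l2 t j.
Proof.
move=> Pt; have [_ Vt] := Pgt0 Pt.
rewrite divr_gt0 //; apply: out_avg_gt0 => //.
have n20 : 0 < n2%:R :> R by rewrite ltr0n (leq_trans _ (ltn_ord j)).
(* The usage count of this input contains the summand of use [j] at the messages and relay outputs
   of [t], which is positive because [P t] is. *)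
rewrite -(pmulr_rgt0 _ n20) px_usage (bigD1 j) //= ltr_pwDl //.
  rewrite pmulr_rgt0 // (bigD1 t.1) //= ltr_pwDl //; last first.
    by do 3! (apply: sumr_ge0 => ? _); rewrite mulr_ge0.
  rewrite (bigD1 t.2.1) //= ltr_pwDl //; last first.
    by do 2! (apply: sumr_ge0 => ? _); rewrite mulr_ge0.
  rewrite (bigD1 t.2.2.1) //= ltr_pwDl //; last first.
    by apply: sumr_ge0 => ? _; rewrite mulr_ge0.
  rewrite eqxx mulr1 lt_def ph1_ge0 andbT; apply/eqP => h; move: Pt.
  by rewrite /P h mul0r mulr0 ltxx.
apply: sumr_ge0 => ? _; rewrite mulr_ge0 ?(ltW c0) //.
by do 3! (apply: sumr_ge0 => ? _); rewrite mulr_ge0.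
Qed.

Let ln_prod (I : finType) (F : I -> R) : (forall i, 0 < F i) ->
  ln (\prod_i F i) = \sum_i ln (F i) /\ 0 < \prod_i F i.
Proof.
move=> F0; apply: (big_ind2 (fun p l => ln p = l /\ 0 < p)) => // [|x l y l' [<- x0] [<- y0]].
  by rewrite ln1.
by rewrite lnM ?posrE // mulr_gt0.
Qed.

Let gain_gt0 t : 0 < gain t.
Proof. by rewrite /gain; case: ifP => // _; rewrite ltr0n. Qed.

Let lik_gt0 t : 0 < P t -> 0 < lik t.
Proof.
move=> Pt; rewrite !mulr_gt0 // prodr_gt0 // => i _; rewrite invr_gt0.
  exact: l1_gt0.
exact: l2_gt0.
Qed.

Let ln_lik t : 0 < P t ->
  ln (lik t) = (ok t)%:R * ln Ma%:R - \sum_k ln (l1 t k) - \sum_j ln (l2 t j).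
Proof.
move=> Pt.
have i1 k : 0 < (l1 t k)^-1 by rewrite invr_gt0 l1_gt0.
have i2 j : 0 < (l2 t j)^-1 by rewrite invr_gt0 l2_gt0.
have [[e1 p1] [e2 p2]] := (ln_prod i1, ln_prod i2).
rewrite /lik !lnM ?posrE ?mulr_gt0 // e1 e2.
have -> : ln (gain t) = (ok t)%:R * ln Ma%:R.
  by rewrite /gain; case: ifP; rewrite ?mul1r // ln1 mul0r.
rewrite (eq_bigr (fun k => - ln (l1 t k))) => [|k _]; last by rewrite lnV ?posrE ?l1_gt0.
rewrite [X in _ + X + _](eq_bigr (fun k => - ln (l2 t k))) => [|k _]; last first.
  by rewrite lnV ?posrE ?l2_gt0.
by rewrite !sumrN; ring.
Qed.

(** Reference laws after the change of measure: [avg_u] for the observation given [wb], and [avg_z]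
    for the sink output given the observation. Neither involves [wa]; [avg_z] may have mass below
    1. *)
Let avg_u wb (u : {ffun 'I_n1 -> U}) : R :=
  \prod_k obs_given_b W phi (pea k) (eb wb k) (u k).
Let avg_z (u : {ffun 'I_n1 -> U}) (z : {ffun 'I_n2 -> Yo}) : R :=
  \prod_j out_given_cut V psi px (xi u j) (z j).

Let pea_pmf k : is_pmf (pea k).
Proof. exact: empirical_pmf. Qed.

Let avg_u_ge0 wb u : 0 <= avg_u wb u.
Proof. by apply: prodr_ge0 => k _; have [] := obs_avg_pmf phi HW (eb wb k) (pea_pmf k). Qed.

Let avg_z_ge0 u z : 0 <= avg_z u z.
Proof. by apply: prodr_ge0 => k _; apply: out_avg_ge0. Qed.

Let sum_avg_z_le1 u : \sum_z avg_z u z <= 1.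
Proof.
rewrite -(bigA_distr_bigA (fun j z => out_given_cut V psi px (xi u j) z)).
apply: prodr_ile1 => j _; rewrite sum_out_avg_le1 // sumr_ge0 // => z _.
exact: out_avg_ge0.
Qed.

Let sum_avg_u wb : \sum_u avg_u wb u = 1.
Proof.
apply: (@sum_ffun_prod1 R _ _ (fun k => obs_given_b W phi (pea k) (eb wb k))) => k.
by have [] := obs_avg_pmf phi HW (eb wb k) (pea_pmf k).
Qed.

Let g wa wb (z : {ffun 'I_n2 -> Yo}) : R := if dec wb z == wa then Ma%:R else 1.

Let g_ge0 wa wb z : 0 <= g wa wb z.
Proof. by rewrite /g; case: ifP. Qed.

(** The decoded message has weight [Ma] and each of the others weight 1, so the total is
    [2 * Ma - 1]. This is the source of the [ln 2] in the converse. *)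
Let sum_g wb z : \sum_wa g wa wb z <= 2 * Ma%:R.
Proof.
rewrite (bigD1 (dec wb z)) //= {1}/g eqxx mulr_natl mulr2n lerD2l.
apply: (@le_trans _ _ (\sum_(wa : 'I_Ma) 1)); last by rewrite sumr_const card_ord.
rewrite [leRHS](bigD1 (dec wb z)) //= -[leLHS]add0r lerD // ler_sum // => wa.
by rewrite /g eq_sym => /negPf ->.
Qed.

(** [F] sees [y] only through the observation, and the sum over a fibre factors over the uses. Each
    factor is the reference law, or 0 where the observation law vanishes, hence the inequality. *)
Let change_y wa wb (F : {ffun 'I_n1 -> U} -> R) : (forall u, 0 <= F u) ->
  \sum_y ph1 wa wb y * \prod_k (obs_law W phi (ea wa k) (eb wb k) (phi (y k)) /
     obs_given_b W phi (pea k) (eb wb k) (phi (y k)))^-1 * F [ffun k => phi (y k)] <=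
  \sum_u avg_u wb u * F u.
Proof.
move=> F0; pose q k y := W (ea wa k) (eb wb k) y *
  (obs_law W phi (ea wa k) (eb wb k) (phi y) / obs_given_b W phi (pea k) (eb wb k) (phi y))^-1.
rewrite (partition_big (fun y : {ffun _ -> _} => [ffun k => phi (y k)]) xpredT) //=.
apply: ler_sum => u _.
rewrite (eq_bigr (fun y : {ffun _ -> _} => (\prod_k q k (y k)) * F u)); last first.
  by move=> y /eqP <-; rewrite /q big_split.
rewrite -mulr_suml ler_wpM2r //.
rewrite (eq_bigl (fun y : {ffun _ -> _} => [forall k, phi (y k) == u k])); last first.
  move=> y; apply/eqP/forallP => [<- k|h]; first by rewrite ffunE.
  by apply/ffunP => k; rewrite ffunE (eqP (h k)).
rewrite sum_ffun_prod_family; apply: ler_prod => k _.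
have [Ku0 _] := obs_pmf phi HW (ea wa k) (eb wb k).
have [T0 _] := obs_avg_pmf phi HW (eb wb k) (pea_pmf k).
rewrite (eq_bigr (fun y => W (ea wa k) (eb wb k) y *
  (obs_law W phi (ea wa k) (eb wb k) (u k) /
    obs_given_b W phi (pea k) (eb wb k) (u k))^-1)); last first.
  by move=> y /eqP <-.
rewrite -mulr_suml -/(obs_law W phi _ _ (u k)) invf_div.
have [->|K0] := eqVneq (obs_law W phi (ea wa k) (eb wb k) (u k)) 0.
  by rewrite mul0r lexx T0.
by rewrite mulrC mulfVK // T0 lexx.
Qed.

(** Holds term by term: each [V] cancels or is 0, and by [rel_xi] the conditioning value in the
    remaining reference law is a function of the observation. *)
Let change_z y (F : {ffun 'I_n2 -> Yo} -> R) : (forall z, 0 <= F z) ->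
  \sum_z ph2 y z * (\prod_j (V (rel y j) (z j) /
     out_given_cut V psi px (psi (rel y j)) (z j))^-1 * F z) <=
  \sum_z avg_z [ffun k => phi (y k)] z * F z.
Proof.
move=> F0; apply: ler_sum => z _; rewrite mulrA ler_wpM2r // -big_split /=.
apply: ler_prod => j _; rewrite -rel_xi invf_div mulrC.
have [V0 _] := HV (rel y j); have T0 := out_avg_ge0 psi HV (psi (rel y j)) (z j) px0.
have [->|Vn0] := eqVneq (V (rel y j) (z j)) 0; first by rewrite mulr0 lexx T0.
by rewrite mulfVK // T0 lexx.
Qed.

(** After both changes of measure [wa] survives only in [g]. Summing over it first gives [2 * Ma],
    the reference laws add a factor at most 1, and the sum over [wb] gives [Mb]. *)
Let sum_lik : \sum_t P t * lik t <= 2.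
Proof.
rewrite sum_P ler_pdivrMl; last by rewrite -invr_gt0.
apply: (@le_trans _ _ (\sum_wa \sum_wb \sum_u avg_u wb u * \sum_z avg_z u z * g wa wb z)).
  apply: ler_sum => wa _; apply: ler_sum => wb _.
  have G0 u : 0 <= \sum_z avg_z u z * g wa wb z.
    by apply: sumr_ge0 => z _; rewrite mulr_ge0.
  apply: le_trans (change_y wa wb G0).
  apply: ler_sum => y _; rewrite -mulrA ler_wpM2l //.
  set c := \prod_k (_ / _)^-1; have c_ge0 : 0 <= c.
    apply: prodr_ge0 => k _; rewrite invr_ge0 divr_ge0 //.
      by have [] := obs_pmf phi HW (ea wa k) (eb wb k).
    by have [] := obs_avg_pmf phi HW (eb wb k) (pea_pmf k).
  apply: le_trans (ler_wpM2l c_ge0 (change_z y (g_ge0 wa wb))).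
  rewrite mulr_sumr le_eqVlt; apply/orP; left; apply/eqP; apply: eq_bigr => z _.
  by rewrite /lik /gain /ok /l1 /l2 /g /c /=; ring.
rewrite exchange_big /= natrM.
apply: (@le_trans _ _ (\sum_(wb < Mb) 2 * Ma%:R)); last first.
  by rewrite sumr_const card_ord -mulr_natr; lra.
apply: ler_sum => wb _; rewrite exchange_big /=.
rewrite -[leRHS]mul1r -[X in _ <= X * _](sum_avg_u wb) mulr_suml; apply: ler_sum => u _.
rewrite -mulr_sumr ler_wpM2l // exchange_big /=.
apply: (@le_trans _ _ (\sum_z avg_z u z * (2 * Ma%:R))).
  by apply: ler_sum => z _; rewrite -mulr_sumr ler_wpM2l.
rewrite -mulr_suml ler_piMl // mulr_ge0 //.
Qed.

(** Jensen's inequality for [lik] with constant 2; the mean of [ln lik] is the success probability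
    times [ln Ma] minus the information terms. *)
Lemma converse_bound :
  (1 - (Ma * Mb)%:R^-1 * \sum_wa \sum_wb \sum_y ph1 wa wb y *
     \sum_z ph2 y z * (dec wb z != wa)%:R) * ln Ma%:R - ln 2 <=
  \sum_k phase1_info W phi (pea k) (peb k) + n2%:R * phase2_info V psi px.
Proof.
have P0 t : 0 <= P t by rewrite mulr_ge0 ?(ltW c0) // mulr_ge0.
have P1 : \sum_t P t = 1.
  have := sum_P1 (fun _ _ _ => 1); under eq_bigr do rewrite mulr1.
  move=> ->; under eq_bigr do under eq_bigr do under eq_bigr do rewrite mulr1.
  under eq_bigr do under eq_bigr do rewrite sum_ph1.
  by rewrite !sumr_const !card_ord -mulrnA [(Mb * Ma)%N]mulnC mulVf // gt_eqF // -invr_gt0.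
have := sum_ln_le P0 P1 lik_gt0 (ltr0Sn R 1) sum_lik.
(* Success is written as one minus failure, to match the error term; points of mass zero contribute
   nothing. *)
rewrite (eq_bigr (fun t => P t * ln Ma%:R - P t * (~~ ok t)%:R * ln Ma%:R
    - \sum_k P t * ln (l1 t k) - P t * \sum_j ln (l2 t j))); last first.
  move=> t _; have [->|Pt0] := eqVneq (P t) 0.
    by rewrite !mul0r big1 ?subrr ?subr0 // => k _; rewrite mul0r.
  have Pt : 0 < P t by rewrite lt_def Pt0 P0.
  by rewrite ln_lik // -mulr_sumr; case: (ok t) => /=; ring.
rewrite !sumrB sum_l2 exchange_big /= -!mulr_suml P1.
rewrite (eq_bigr (fun k => phase1_info W phi (pea k) (peb k))); last by move=> k _; rewrite sum_l1.
rewrite (sum_P (fun t => (~~ ok t)%:R)) /ok /=.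
lra.
Qed.

End Converse.

(** * Single-letter expressions *)

Section TimeSharing.
Context {R : realType} (T A B Y U : finType) (K : nat).
Variables (W : A -> B -> Y -> R) (phi : Y -> U) (P : T -> R).
Variables (rq : T -> 'I_K) (ra : T -> A) (rb : T -> B) (ru : T -> U).
Variables (pq : 'I_K -> R) (pa : 'I_K -> A -> R) (pb : 'I_K -> B -> R).
Hypothesis HW : forall a b, is_pmf (W a b).
Hypothesis Hpa : forall q, is_pmf (pa q).
Hypothesis P0 : forall t, 0 <= P t.
Hypothesis law : forall q a b u,
  prob P (fun t => [&& rq t == q, ra t == a, rb t == b & ru t == u]) =
  pq q * pa q a * pb q b * obs_law W phi a b u.

(** An instance of [cmi_channel] with input [(a, (b, q))]. Given [q] the two inputs are independent,
    so conditioning on [(b, q)] leaves [a] with law [pa q]. *)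
Lemma cmi_timeshare :
  cmi P ra ru (fun t => (rb t, rq t)) = (ln 2)^-1 * \sum_q pq q * phase1_info W phi (pa q) (pb q).
Proof.
pose X t := (ra t, (rb t, rq t)).
pose r (x : A * (B * 'I_K)) := pq x.2.2 * pa x.2.2 x.1 * pb x.2.2 x.2.1.
have fg (x x' : A * (B * 'I_K)) : x.1 = x'.1 -> x.2 = x'.2 -> x = x'.
  by case: x x' => ? ? [? ?] /= -> ->.
have K1 (x : A * (B * 'I_K)) : \sum_u obs_law W phi x.1 x.2.1 u = 1.
  by have [] := obs_pmf phi HW x.1 x.2.1.
rewrite (@cmi_channel R _ _ _ _ _ P X ru fst snd r (fun x => obs_law W phi x.1 x.2.1) P0 fg K1);
  last first.
  move=> [a [b q]] u; rewrite /r /= -law; apply: eq_bigl => t; rewrite !xpair_eqE.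
  by case: (rq t == q); case: (ra t == a); case: (rb t == b); case: (_ == u).
have fib c (G : A * (B * 'I_K) -> R) : \sum_(x | x.2 == c) G x = \sum_a G (a, c).
  rewrite big_mkcond sum_pair; apply: eq_bigr => a _.
  by rewrite -big_mkcond /= big_pred1_eq.
rewrite sum_pair exchange_big sum_pair exchange_big /= mulr_sumr.
apply: eq_bigr => q _; rewrite exchange_big /= mulrCA /phase1_info !mulr_sumr.
apply: eq_bigr => a _; rewrite !mulr_sumr.
apply: eq_bigr => b _; rewrite !mulr_sumr.
apply: eq_bigr => u _; rewrite !fib /r /=.
(* A pair [(b, q)] of mass zero contributes nothing; otherwise its mass cancels from the conditional
   output law. *)
have [r0|r0] := eqVneq (pq q * pb q b) 0.
  have -> : pq q * pa q a * pb q b = 0 by rewrite mulrAC r0 mul0r.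
  rewrite mul0r; transitivity ((ln 2)^-1 * (pq q * pb q b) * pa q a *
    (obs_law W phi a b u * ln (obs_law W phi a b u / obs_given_b W phi (pa q) b u))); last by ring.
  by rewrite r0 mulr0 !mul0r.
rewrite (eq_bigr (fun a' => (pq q * pb q b) * (pa q a' * obs_law W phi a' b u))); last first.
  by move=> a' _; ring.
rewrite [X in _ / (_ / X)](eq_bigr (fun a' => (pq q * pb q b) * pa q a')); last first.
  by move=> a' _; ring.
rewrite -!mulr_sumr; have [_ ->] := Hpa q.
rewrite mulr1 (_ : _ * _ / _ = obs_given_b W phi (pa q) b u); last by rewrite mulrAC divff ?mul1r.
by rewrite /log2; ring.
Qed.

End TimeSharing.

Lemma restr_inj m (F : 'I_m -> finType) (S : {set 'I_m}) (x x' : relvec F) :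
  restr S x = restr S x' -> restr (~: S) x = restr (~: S) x' -> x = x'.
Proof.
move=> e1 e2; apply/ffunP => i.
have := congr1 (fun f : {dffun _} => f i) e1; have := congr1 (fun f : {dffun _} => f i) e2.
by rewrite !ffunE inE; case: (i \in S) => /= [_ []|[]].
Qed.

(** * Mutual informations under the outer-bound distribution *)

Section SingleLetter.
Context {R : realType} (m : nat) (Xa Xb Ya Yb : finType) (XR YR : 'I_m -> finType).
Variables (W1 : Xa -> Xb -> relvec YR -> R) (W2 : relvec XR -> Ya * Yb -> R).
Hypothesis HW1 : forall xa xb, is_pmf (W1 xa xb).
Hypothesis HW2 : forall x, is_pmf (W2 x).
Context (K : nat) (pq : 'I_K -> R) (pa : 'I_K -> Xa -> R) (pb : 'I_K -> Xb -> R)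
  (px : relvec XR -> R).
Hypotheses (Hpq : is_pmf pq) (Hpa : forall q, is_pmf (pa q)) (Hpb : forall q, is_pmf (pb q))
  (Hpx : is_pmf px).

Let P := @outer_pmf R m Xa Xb Ya Yb XR YR W1 W2 K pq pa pb px.

(** Phase 1 with the terminals exchanged, so that the bounds for one direction yield the other. *)
Definition flip_channel (xb : Xb) (xa : Xa) := W1 xa xb.
Definition chan_a (x : relvec XR) (ya : Ya) : R := \sum_yb W2 x (ya, yb).
Definition chan_b (x : relvec XR) (yb : Yb) : R := \sum_ya W2 x (ya, yb).

Lemma chan_a_pmf x : is_pmf (chan_a x).
Proof.
split=> [ya|]; first by apply: sumr_ge0 => yb _; have [] := HW2 x.
by rewrite -(sum_pair (W2 x)); have [] := HW2 x.
Qed.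

Lemma chan_b_pmf x : is_pmf (chan_b x).
Proof.
split=> [yb|]; first by apply: sumr_ge0 => ya _; have [] := HW2 x.
by rewrite exchange_big -(sum_pair (W2 x)); have [] := HW2 x.
Qed.

Lemma outer_pmf_ge0 t : 0 <= P t.
Proof.
case: t => [[[[[[q xa] xb] yR] xR] ya] yb] /=.
have [[h1 _] [h2 _] [h3 _]] := And3 Hpq (Hpa q) (Hpb q).
have [[h4 _] [h5 _] [h6 _]] := And3 Hpx (HW1 xa xb) (HW2 xR).
by rewrite !mulr_ge0.
Qed.

Lemma sum_outer (F : 'I_K -> Xa -> Xb -> relvec YR -> relvec XR -> Ya -> Yb -> R) :
  \sum_t P t * F (rvQ t) (rvXa t) (rvXb t) (rvYR t) (rvXR t) (rvYa t) (rvYb t) =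
  \sum_q pq q * \sum_xa pa q xa * \sum_xb pb q xb * \sum_yR W1 xa xb yR *
    \sum_xR px xR * \sum_ya \sum_yb W2 xR (ya, yb) * F q xa xb yR xR ya yb.
Proof.
rewrite !sum_pair; apply: eq_bigr => q _; rewrite mulr_sumr; apply: eq_bigr => xa _.
rewrite !mulr_sumr; apply: eq_bigr => xb _; rewrite !mulr_sumr; apply: eq_bigr => yR _.
rewrite !mulr_sumr; apply: eq_bigr => xR _; rewrite !mulr_sumr; apply: eq_bigr => ya _.
by rewrite !mulr_sumr; apply: eq_bigr => yb _ /=; ring.
Qed.

(** The two phases are independent under [outer_pmf], so phase 2 sums out to 1. *)
Lemma sum_outer1 (F : 'I_K -> Xa -> Xb -> relvec YR -> R) :
  \sum_t P t * F (rvQ t) (rvXa t) (rvXb t) (rvYR t) =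
  \sum_q pq q * \sum_xa pa q xa * \sum_xb pb q xb * \sum_yR W1 xa xb yR * F q xa xb yR.
Proof.
rewrite (sum_outer (fun q xa xb yR _ _ _ => F q xa xb yR)).
apply: eq_bigr => q _; congr (_ * _); apply: eq_bigr => xa _; congr (_ * _).
apply: eq_bigr => xb _; congr (_ * _); apply: eq_bigr => yR _; congr (_ * _).
under eq_bigr => xR _.
  under eq_bigr do rewrite -mulr_suml.
  rewrite -mulr_suml -(sum_pair (W2 xR)); have [_ ->] := HW2 xR; rewrite mul1r; over.
by rewrite -mulr_suml; have [_ ->] := Hpx; rewrite mul1r.
Qed.

Lemma sum_outer2 (F : relvec XR -> Ya -> Yb -> R) :
  \sum_t P t * F (rvXR t) (rvYa t) (rvYb t) =
  \sum_xR px xR * \sum_ya \sum_yb W2 xR (ya, yb) * F xR ya yb.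
Proof.
rewrite (sum_outer (fun _ _ _ _ xR ya yb => F xR ya yb)).
under eq_bigr => q _.
  under eq_bigr => xa _.
    under eq_bigr => xb _.
      rewrite -mulr_suml; have [_ ->] := HW1 xa xb; rewrite mul1r; over.
    rewrite -mulr_suml; have [_ ->] := Hpb q; rewrite mul1r; over.
  rewrite -mulr_suml; have [_ ->] := Hpa q; rewrite mul1r; over.
by rewrite -mulr_suml; have [_ ->] := Hpq; rewrite mul1r.
Qed.

Lemma prob_sum (T : finType) (p : T -> R) (E : pred T) : prob p E = \sum_t p t * (E t)%:R.
Proof.
rewrite /prob big_mkcond; apply: eq_bigr => t _; case: (E t); by rewrite ?mulr1 ?mulr0.
Qed.

(** An instance of [cmi_channel]: the restrictions to [S] and its complement determine the relay
    inputs. *)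
Lemma cmi_phase2_b S :
  cmi P (fun t => restr S (rvXR t)) (@rvYb _ _ _ _ _ XR YR K) (fun t => restr (~: S) (rvXR t)) =
  (ln 2)^-1 * phase2_info chan_b (restr (~: S)) px.
Proof.
rewrite (@cmi_channel R _ _ _ _ _ P (@rvXR _ _ _ _ _ XR YR K) (@rvYb _ _ _ _ _ XR YR K)
  (restr S) (restr (~: S)) px chan_b outer_pmf_ge0 (@restr_inj _ _ S)); first last.
- move=> x yb; rewrite prob_sum.
  transitivity (\sum_t P t * (fun x' _ yb' => (x == x')%:R * (yb == yb')%:R)
     (rvXR t) (rvYa t) (rvYb t)).
    by apply: eq_bigr => t _; rewrite -natrM mulnb (eq_sym x) (eq_sym yb).
  rewrite (sum_outer2 (fun x' _ yb' => (x == x')%:R * (yb == yb')%:R)).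
  rewrite -(sum_delta x (fun x => px x * chan_b x yb)); apply: eq_bigr => x' _.
  rewrite mulrCA; congr (_ * _); rewrite mulr_sumr; apply: eq_bigr => ya _.
  rewrite -(sum_delta yb (fun yb => (x == x')%:R * W2 x' (ya, yb))).
  by apply: eq_bigr => yb' _; ring.
- by move=> x; have [] := chan_b_pmf x.
rewrite /phase2_info mulr_sumr; apply: eq_bigr => x _; rewrite mulrCA; congr (_ * _).
by rewrite mulr_sumr; apply: eq_bigr => yb _; rewrite /log2 /out_given_cut; ring.
Qed.

Lemma cmi_phase2_a S :
  cmi P (fun t => restr S (rvXR t)) (@rvYa _ _ _ _ _ XR YR K) (fun t => restr (~: S) (rvXR t)) =
  (ln 2)^-1 * phase2_info chan_a (restr (~: S)) px.
Proof.
rewrite (@cmi_channel R _ _ _ _ _ P (@rvXR _ _ _ _ _ XR YR K) (@rvYa _ _ _ _ _ XR YR K)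
  (restr S) (restr (~: S)) px chan_a outer_pmf_ge0 (@restr_inj _ _ S)); first last.
- move=> x ya; rewrite prob_sum.
  transitivity (\sum_t P t * (fun x' ya' _ => (x == x')%:R * (ya == ya')%:R)
     (rvXR t) (rvYa t) (rvYb t)).
    by apply: eq_bigr => t _; rewrite -natrM mulnb (eq_sym x) (eq_sym ya).
  rewrite (sum_outer2 (fun x' ya' _ => (x == x')%:R * (ya == ya')%:R)).
  rewrite -(sum_delta x (fun x => px x * chan_a x ya)); apply: eq_bigr => x' _.
  rewrite mulrCA; congr (_ * _).
  rewrite -(sum_delta ya (fun ya => (x == x')%:R * \sum_yb W2 x' (ya, yb))).
  apply: eq_bigr => ya' _; rewrite !mulr_sumr.
  by apply: eq_bigr => yb _; ring.
- by move=> x; have [] := chan_a_pmf x.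
rewrite /phase2_info mulr_sumr; apply: eq_bigr => x _; rewrite mulrCA; congr (_ * _).
by rewrite mulr_sumr; apply: eq_bigr => yb _; rewrite /log2 /out_given_cut; ring.
Qed.

Section Phase1.
Variables (U : finType) (phi : relvec YR -> U).

Lemma outer_law1 q xa xb u :
  prob P (fun t => [&& rvQ t == q, rvXa t == xa, rvXb t == xb & phi (rvYR t) == u]) =
  pq q * pa q xa * pb q xb * obs_law W1 phi xa xb u.
Proof.
pose F q' xa' xb' y : R :=
  (q == q')%:R * ((xa == xa')%:R * ((xb == xb')%:R * (phi y == u)%:R)).
rewrite prob_sum.
transitivity (\sum_t P t * F (rvQ t) (rvXa t) (rvXb t) (rvYR t)).
  apply: eq_bigr => t _; congr (_ * _); rewrite /F -!natrM !mulnb.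
  by rewrite (eq_sym q) (eq_sym xa) (eq_sym xb).
rewrite sum_outer1.
have E (A : finType) (a : A) (f G : A -> R) :
  \sum_x f x * ((a == x)%:R * G x) = f a * G a.
  by rewrite -(sum_delta a (fun x => f x * G x)); apply: eq_bigr => x _; ring.
transitivity (\sum_q' pq q' * ((q == q')%:R * \sum_xa' pa q' xa' * ((xa == xa')%:R *
     \sum_xb' pb q' xb' * ((xb == xb')%:R * obs_law W1 phi xa' xb' u)))).
  apply: eq_bigr => q' _; congr (_ * _).
  rewrite mulr_sumr; apply: eq_bigr => xa' _; rewrite !mulr_sumr.
  apply: eq_bigr => xb' _; rewrite -[obs_law _ _ _ _ _]/(prob _ _) prob_sum !mulr_sumr.
  by apply: eq_bigr => y _; rewrite /F; ring.
by rewrite E E E; ring.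
Qed.

Lemma cmi_phase1_a :
  cmi P (@rvXa _ _ _ _ _ XR YR K) (fun t => phi (rvYR t)) (fun t => (rvXb t, rvQ t)) =
  (ln 2)^-1 * \sum_q pq q * phase1_info W1 phi (pa q) (pb q).
Proof. by apply: cmi_timeshare => //; [exact: outer_pmf_ge0 | exact: outer_law1]. Qed.

Lemma cmi_phase1_b :
  cmi P (@rvXb _ _ _ _ _ XR YR K) (fun t => phi (rvYR t)) (fun t => (rvXa t, rvQ t)) =
  (ln 2)^-1 * \sum_q pq q * phase1_info flip_channel phi (pb q) (pa q).
Proof.
apply: cmi_timeshare => //; [by move=> xb xa; apply: HW1 | exact: outer_pmf_ge0 |].
move=> q xb xa u; rewrite [pq q * _ * _]mulrAC.
rewrite -[obs_law _ _ _ _ _]/(obs_law W1 phi xa xb u) -outer_law1.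
by apply: eq_bigl => t; rewrite (andbCA (rvXb t == xb)).
Qed.

End Phase1.
End SingleLetter.

(** * Bounds for a given code *)

Section Aux.
Context {R : realType}.

Lemma delta_pmf (T : finType) (x0 : T) : is_pmf (fun x => (x0 == x)%:R : R).
Proof.
split=> [x|]; first by rewrite ler0n.
by rewrite -[RHS](sum_delta x0 (fun=> 1 : R)); apply: eq_bigr => x _; rewrite mulr1.
Qed.

Lemma average_usage (Om X : finType) (p : Om -> R) n (x : Om -> 'I_n -> X) (x0 : X) :
  is_pmf p -> exists2 px : X -> R, is_pmf px &
    forall a, n%:R * px a = \sum_j \sum_t p t * (x t j == a)%:R.
Proof.
move=> [p0 p1]; have [n0|n0] := posnP n.
  (* Without uses both sides vanish, and a point mass serves as the law. *)
  exists (fun a => (x0 == a)%:R); first exact: delta_pmf.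
  move=> a; rewrite big1 ?n0 ?mul0r // => j _.
  by have := ltn_ord j; rewrite [X in (_ < X)%N]n0.
exists (fun a => n%:R^-1 * \sum_j \sum_t p t * (x t j == a)%:R); last first.
  by move=> a; rewrite mulrA divff ?mul1r // pnatr_eq0 -lt0n.
split=> [a|].
  rewrite mulr_ge0 ?invr_ge0 // sumr_ge0 // => j _; rewrite sumr_ge0 // => t _.
  by rewrite mulr_ge0.
rewrite -mulr_sumr exchange_big /= (eq_bigr (fun=> 1)).
  by rewrite sumr_const card_ord mulVf // pnatr_eq0 -lt0n.
move=> j _; rewrite exchange_big /= -[RHS]p1; apply: eq_bigr => t _.
by rewrite -mulr_sumr (proj2 (delta_pmf (x t j))) mulr1.
Qed.

(** A constant observation has the same 0-1 valued law for every input, so all logarithms are those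
    of 1 or have weight 0. *)
Lemma phase1_info_const (Xa Xb Yr U : finType) (W : Xa -> Xb -> Yr -> R) (phi : Yr -> U)
    (pa : Xa -> R) (pb : Xb -> R) :
  (forall xa xb, is_pmf (W xa xb)) -> is_pmf pa -> (forall y y', phi y = phi y') ->
  phase1_info W phi pa pb = 0.
Proof.
move=> HW [_ pa1] phic; rewrite /phase1_info.
rewrite big1 // => xa _; rewrite big1 ?mulr0 // => xb _; rewrite big1 ?mulr0 // => u _.
have E x : obs_law W phi x xb u = [exists y, phi y == u]%:R.
  rewrite /obs_law; case: existsP => [[y /eqP <-]|nex].
    rewrite -[RHS](proj2 (HW x xb)); apply: eq_bigl => y'.
    by rewrite (phic y' y) eqxx.
  by rewrite big1 // => y yu; case: nex; exists y.
rewrite /obs_given_b; under eq_bigr do rewrite E.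
rewrite -mulr_suml pa1 mul1r E; case: [exists y, _]; last by rewrite mul0r.
by rewrite mul1r divr1 ln1.
Qed.

End Aux.

(** * Single-letter bound for one code, all cuts at once *)

Section CodeBound.
Context {R : realType} (m : nat) (Xa Xb Ya Yb : finType) (XR YR : 'I_m -> finType).
Variables (W1 : Xa -> Xb -> relvec YR -> R) (W2 : relvec XR -> Ya * Yb -> R).
Hypothesis HW1 : forall xa xb, is_pmf (W1 xa xb).
Hypothesis HW2 : forall x, is_pmf (W2 x).
Hypotheses (HXa : (0 < #|Xa|)%N) (HXb : (0 < #|Xb|)%N) (HXR : forall i, (0 < #|XR i|)%N).

Lemma relvec_inhabited : relvec XR.
Proof. by apply: finfun => i; have /card_gt0P/sigW[x _] := HXR i. Qed.

Let K := (2 ^ m.+1)%N.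
Let phi (S : {set 'I_m}) : relvec YR -> _ := restr (~: S).

(** There is one functional per cut and direction, [2 ^ m.+1] in all, so conic Caratheodory
    reweights [K] of the uses while preserving every information sum. *)
Lemma time_sharing n (pea : 'I_n -> Xa -> R) (peb : 'I_n -> Xb -> R) :
  (forall k, is_pmf (pea k)) -> (forall k, is_pmf (peb k)) ->
  exists (pq : 'I_K -> R) (pa : 'I_K -> Xa -> R) (pb : 'I_K -> Xb -> R),
    [/\ is_pmf pq, (forall q, is_pmf (pa q)), (forall q, is_pmf (pb q)) & forall S,
     n%:R * \sum_q pq q * phase1_info W1 (phi S) (pa q) (pb q) =
       \sum_k phase1_info W1 (phi S) (pea k) (peb k) /\
     n%:R * \sum_q pq q * phase1_info (flip_channel W1) (phi S) (pb q) (pa q) =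
       \sum_k phase1_info (flip_channel W1) (phi S) (peb k) (pea k)].
Proof.
move=> Hpea Hpeb; have K0 : (0 < K)%N by rewrite expn_gt0.
have [n0|n0] := posnP n.
  have [/card_gt0P[xa _] /card_gt0P[xb _]] := (HXa, HXb).
  exists (fun q => (Ordinal K0 == q)%:R), (fun _ x => (xa == x)%:R), (fun _ x => (xb == x)%:R).
  split=> [|q|q|S]; try exact: delta_pmf.
  by subst n; rewrite !big_ord0 !mul0r.
pose J : finType := ({set 'I_m} * bool)%type.
(* The cut [S = R] has zero information for [a], which frees its slot for the total mass. *)
pose g (j : J) k := if j == ([set: 'I_m]%SET, true) then 1 else
  if j.2 then phase1_info W1 (phi j.1) (pea k) (peb k)
  else phase1_info (flip_channel W1) (phi j.1) (peb k) (pea k).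
have JK : (#|J| <= K)%N.
  rewrite card_prod card_bool -cardsT -powersetT card_powerset cardsT card_ord.
  by rewrite /K expnSr.
have nR : n%:R != 0 :> R by rewrite pnatr_eq0 -lt0n.
have w0 : 0 <= n%:R^-1 :> R by rewrite invr_ge0.
have [s [v [v0 vE]]] := @conic_caratheodory R J K n g (fun=> n%:R^-1) JK n0
  (fun _ => w0).
have HW1' xb xa : is_pmf (flip_channel W1 xb xa) by apply: HW1.
exists v, (pea \o s), (peb \o s); split=> [|q|q|S]; [|exact: Hpea|exact: Hpeb|].
  split=> //; have := vE ([set: 'I_m]%SET, true); rewrite /g eqxx.
  under eq_bigr do rewrite mulr1; move=> ->.
  by rewrite mulr1 sumr_const card_ord -[_ *+ n]mulr_natl mulfV.
have lift F : \sum_k v k * F (s k) = \sum_k n%:R^-1 * F k ->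
   n%:R * (\sum_k v k * F (s k)) = \sum_k F k :> R.
  by move=> ->; rewrite -mulr_sumr mulrA mulfV // mul1r.
split; last first.
  apply: (lift (fun k => phase1_info (flip_channel W1) (phi S) (peb k) (pea k))).
  by have := vE (S, false); rewrite /g xpair_eqE andbF.
apply: (lift (fun k => phase1_info W1 (phi S) (pea k) (peb k))).
(* For the cut whose slot holds the total mass, both sides are 0. *)
have [->|ST] := eqVneq S [set: 'I_m]%SET; last first.
  by have := vE (S, true); rewrite /g xpair_eqE (negPf ST).
have Z k : phase1_info W1 (phi [set: 'I_m]%SET) (pea k) (peb k) = 0.
  apply: phase1_info_const => // y y'; apply/ffunP => i.
  by rewrite !ffunE !inE.
by rewrite !big1 // => k _; rewrite Z mulr0.
Qed.

Section Code.
Variables (Ma Mb n : nat) (C : mabc_code Xa Xb Ya Yb XR YR Ma Mb n).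
Hypotheses (Ma0 : (0 < Ma)%N) (Mb0 : (0 < Mb)%N).

(** Decoding at [b] ignores [ya]; summing it out turns the product of [W2] into a product of
    marginal channels. *)
Lemma err_bE : err_b W1 W2 C = (Ma * Mb)%:R^-1 * \sum_wa \sum_wb \sum_y
   p_phase1 W1 wa wb y * \sum_(z : {ffun 'I_(n2 C) -> Yb})
     (\prod_j chan_b W2 (relay_inputs y j) (z j)) * (dec_b wb z != wa)%:R.
Proof.
congr (_ * _); apply: eq_bigr => wa _; apply: eq_bigr => wb _; apply: eq_bigr => y _.
rewrite exchange_big /= mulr_sumr; apply: eq_bigr => z _.
rewrite /chan_b bigA_distr_bigA mulrA mulr_sumr mulr_suml; apply: eq_bigr => ya _.
by [].
Qed.

Lemma err_aE : err_a W1 W2 C = (Mb * Ma)%:R^-1 * \sum_wb \sum_wa \sum_y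
   p_phase1 W1 wa wb y * \sum_(z : {ffun 'I_(n2 C) -> Ya})
     (\prod_j chan_a W2 (relay_inputs y j) (z j)) * (dec_a wa z != wb)%:R.
Proof.
rewrite /err_a mulnC exchange_big /=.
congr (_ * _); apply: eq_bigr => wb _; apply: eq_bigr => wa _; apply: eq_bigr => y _.
rewrite mulr_sumr; apply: eq_bigr => z _.
rewrite /chan_a bigA_distr_bigA mulrA mulr_sumr mulr_suml; apply: eq_bigr => yb _.
by [].
Qed.

(** Relay inputs on the sink side, computed from any representative [y] of the observation [u]; the
    default is reached only when [u] is not an observation. *)
Let xi S (u : {ffun 'I_(n1 C) -> {dffun forall i, option (YR i)}}) (j : 'I_(n2 C)) :
    {dffun forall i, option (XR i)} :=
  if [pick y : {ffun 'I_(n1 C) -> relvec YR} | [ffun k => phi S (y k)] == u] is Some y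
  then restr (~: S) (relay_inputs y j) else [ffun=> None].

(** A relay outside [S] acts on its own outputs alone, which [phi S] retains, so the choice of
    representative is immaterial. *)
Lemma relay_inputs_local S (y : {ffun 'I_(n1 C) -> relvec YR}) j :
  restr (~: S) (relay_inputs y j) = xi S [ffun k => phi S (y k)] j.
Proof.
rewrite /xi; case: pickP => [y' /eqP E|/(_ y)]; last by rewrite eqxx.
apply/ffunP => i; rewrite !ffunE; case: ifP => // iS.
congr (Some (relay _ _)); apply/ffunP => k; rewrite !ffunE.
have := congr1 (fun f : {ffun _ -> {dffun _}} => f k i) E.
by rewrite !ffunE iS => -[].
Qed.

(** The laws are chosen before [S]: the same ones serve every cut and both directions. *)
Lemma code_bound :
  exists (pq : 'I_K -> R) (pa : 'I_K -> Xa -> R) (pb : 'I_K -> Xb -> R)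
         (px : relvec XR -> R),
    [/\ is_pmf pq, (forall q, is_pmf (pa q)), (forall q, is_pmf (pb q)),
        is_pmf px &
    forall S : {set 'I_m},
      let P := outer_pmf W1 W2 pq pa pb px in
      (1 - err_b W1 W2 C) * log2 Ma%:R - 1 <=
       (n1 C)%:R * cmi P (@rvXa _ _ _ _ _ XR YR K)
                       (fun t => restr (~: S) (rvYR t))
                       (fun t => (rvXb t, rvQ t))
            + (n2 C)%:R * cmi P (fun t => restr S (rvXR t)) (@rvYb _ _ _ _ _ XR YR K)
                       (fun t => restr (~: S) (rvXR t)) /\
      (1 - err_a W1 W2 C) * log2 Mb%:R - 1 <=
       (n1 C)%:R * cmi P (@rvXb _ _ _ _ _ XR YR K)
                       (fun t => restr (~: S) (rvYR t))
                       (fun t => (rvXa t, rvQ t))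
            + (n2 C)%:R * cmi P (fun t => restr S (rvXR t)) (@rvYa _ _ _ _ _ XR YR K)
                       (fun t => restr (~: S) (rvXR t))].
Proof.
have [pq [pa [pb [Hpq Hpa Hpb TS]]]] :=
  time_sharing (fun k => empirical_pmf (fun w => @enc_a _ _ _ _ _ _ _ _ _ _ C w k) Ma0)
    (fun k => empirical_pmf (fun w => @enc_b _ _ _ _ _ _ _ _ _ _ C w k) Mb0).
(* Messages and relay outputs form the space over which the relay inputs are averaged to give
   [px]. *)
pose Om : finType := ('I_Ma * ('I_Mb * {ffun 'I_(n1 C) -> relvec YR}))%type.
pose p (t : Om) : R := (Ma * Mb)%:R^-1 * p_phase1 W1 t.1 t.2.1 t.2.2.
have pE F : \sum_t p t * F t.1 t.2.1 t.2.2 = (Ma * Mb)%:R^-1 *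
    \sum_wa \sum_wb \sum_y p_phase1 W1 wa wb y * F wa wb y.
  rewrite sum_pair mulr_sumr; apply: eq_bigr => wa _.
  rewrite sum_pair mulr_sumr; apply: eq_bigr => wb _.
  by rewrite mulr_sumr; apply: eq_bigr => y _; rewrite mulrA.
have Hp : is_pmf p.
  split=> [t|].
    rewrite mulr_ge0 ?invr_ge0 // prodr_ge0 // => k _.
    by have [] := HW1 (enc_a t.1 k) (enc_b t.2.1 k).
  have := pE (fun _ _ _ => 1); under eq_bigr do rewrite mulr1.
  move=> ->; under eq_bigr do under eq_bigr do under eq_bigr do rewrite mulr1.
  rewrite (eq_bigr (fun=> Mb%:R)) => [|wa _]; last first.
    rewrite (eq_bigr (fun=> 1)) ?sumr_const ?card_ord // => wb _.
    apply: (@sum_ffun_prod1 R _ _ (fun k => W1 (enc_a wa k) (enc_b wb k))) => k.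
    by have [] := HW1 (enc_a wa k) (enc_b wb k).
  rewrite !sumr_const !card_ord -mulrnA [(Mb * Ma)%N]mulnC mulVf //.
  by rewrite pnatr_eq0 -lt0n muln_gt0 Ma0.
have [px Hpx use] := average_usage
  (fun (t : Om) j => @relay_inputs _ _ _ _ _ _ _ _ _ _ C t.2.2 j) relvec_inhabited Hp.
exists pq, pa, pb, px; split=> // S P; have [TSa TSb] := TS S.
have ln2_inv : 0 < (ln 2)^-1 :> R by rewrite invr_gt0 ln2_gt0.
have usage_ab x : (n2 C)%:R * px x = \sum_j (Ma * Mb)%:R^-1 *
    \sum_wa \sum_wb \sum_y p_phase1 W1 wa wb y * (@relay_inputs _ _ _ _ _ _ _ _ _ _ C y j == x)%:R.
  by rewrite use; apply: eq_bigr => j _; rewrite -pE.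
have usage_ba x : (n2 C)%:R * px x = \sum_j (Mb * Ma)%:R^-1 *
    \sum_wb \sum_wa \sum_y p_phase1 W1 wa wb y * (@relay_inputs _ _ _ _ _ _ _ _ _ _ C y j == x)%:R.
  by rewrite usage_ab mulnC; apply: eq_bigr => j _; rewrite exchange_big.
(* Passage from nats to bits, with the phase-1 sum replaced by its time-sharing form. *)
have scale (e l A A' B x y : R) : x * A' = A -> e * l - ln 2 <= A + y * B ->
    e * (l / ln 2) - 1 <= x * ((ln 2)^-1 * A') + y * ((ln 2)^-1 * B).
  move=> <-; rewrite -(ler_pM2l ln2_inv) => H.
  have := H; rewrite mulrBr mulVf ?gt_eqF ?ln2_gt0 // => {}H.
  apply: le_trans (le_trans H _).
    by rewrite le_eqVlt; apply/orP; left; apply/eqP; ring.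
  by rewrite le_eqVlt; apply/orP; left; apply/eqP; ring.
split.
- rewrite cmi_phase1_a // cmi_phase2_b // err_bE; apply: scale TSa _.
  exact: (converse_bound HW1 (chan_b_pmf HW2) (@dec_b _ _ _ _ _ _ _ _ _ _ C) Ma0 Mb0
    (relay_inputs_local S) (proj1 Hpx) usage_ab).
- rewrite cmi_phase1_b // cmi_phase2_a // err_aE; apply: scale TSb _.
  (* With the terminals exchanged the phase-1 likelihood is the same up to conversion. *)
  exact: (converse_bound (W := flip_channel W1) (fun xb xa => HW1 xa xb)
    (chan_a_pmf HW2) (@dec_a _ _ _ _ _ _ _ _ _ _ C) Mb0 Ma0
    (relay_inputs_local S) (proj1 Hpx) usage_ba).
Qed.

End Code.
End CodeBound.

(** * Limit of long codes *)

Section MsgSize.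
Context {R : realType}.
Implicit Types Rt : R.

Lemma pow2_ge1 Rt n : 0 <= Rt -> 1 <= 2 `^ (Rt * n%:R) :> R.
Proof.
move=> Rt0; rewrite -[leLHS](powRr0 2) ler_powR ?mulr_ge0 // ler1n //.
Qed.

Lemma msg_size_gt0 Rt n : 0 <= Rt -> (0 < msg_size Rt n)%N.
Proof. by move=> Rt0; rewrite /msg_size truncn_gt0 pow2_ge1. Qed.

(** For [x >= 1] the integer part is at least [x / 2], so rounding costs at most one bit. *)
Lemma log2_msg_size_ge Rt n : 0 <= Rt -> Rt * n%:R - 1 <= log2 (msg_size Rt n)%:R.
Proof.
move=> Rt0; have M0 := msg_size_gt0 n Rt0; have ln2 := @ln2_gt0 R.
rewrite /log2 ler_pdivlMr // mulrBl mul1r -ln_powR.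
have x0 : 0 < 2 `^ (Rt * n%:R) :> R by rewrite powR_gt0.
rewrite -ln_div ?posrE // ler_ln ?posrE ?divr_gt0 ?ltr0n //.
rewrite ler_pdivrMr // -natrM.
have /andP[_ /ltW h] := truncn_itv (ltW x0).
by apply: le_trans h _; rewrite ler_nat; move: M0; rewrite /msg_size; lia.
Qed.

Lemma msg_size1_gt0 Rt : (0 < msg_size Rt 1)%N -> 0 <= Rt.
Proof.
rewrite /msg_size truncn_gt0 mulr1 => /ln_ge0.
by rewrite ln_powR pmulr_lge0 // ln2_gt0.
Qed.

End MsgSize.

(** * Zero information of deterministic inputs *)

Section Degenerate.
Context {R : realType}.

Lemma phase1_info_delta (Xa Xb Yr U : finType) (W : Xa -> Xb -> Yr -> R) (phi : Yr -> U) xa0 pb :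
  phase1_info W phi (fun x => (xa0 == x)%:R) pb = 0.
Proof.
rewrite /phase1_info sum_delta big1 // => xb _; rewrite big1 ?mulr0 // => u _.
rewrite /obs_given_b sum_delta; have [->|o0] := eqVneq (obs_law W phi xa0 xb u) 0.
  by rewrite mul0r.
by rewrite divff // ln1 mulr0.
Qed.

Lemma phase2_info_delta (XX Yo U : finType) (V : XX -> Yo -> R) (psi : XX -> U) x0 :
  phase2_info V psi (fun x => (x0 == x)%:R) = 0.
Proof.
rewrite /phase2_info sum_delta big1 // => z _; rewrite /out_given_cut.
have E (F : XX -> R) : \sum_(x | psi x == psi x0) (x0 == x)%:R * F x = F x0.
  rewrite -[RHS](sum_delta x0 F) [LHS]big_mkcond; apply: eq_bigr => x _.
  by have [->|] := eqVneq x0 x; rewrite ?eqxx // mul0r; case: ifP.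
have := E (fun=> 1); under eq_bigr do rewrite mulr1; move=> ->.
rewrite E divr1; have [->|o0] := eqVneq (V x0 z) 0; first by rewrite mul0r.
by rewrite divff // ln1 mulr0.
Qed.

End Degenerate.

(** * Limits along an ultrafilter of block lengths *)

Section Limits.
Context {R : realType}.
Local Open Scope classical_set_scope.
Local Open Scope ring_scope.
Variable U : set_system nat.
Hypothesis UU : UltraFilter U.

(** By compactness the image ultrafilter has a cluster point, and an ultrafilter converges to each
    of its cluster points. *)
Lemma ultra_cvg_bounded (u : nat -> R) (a b : R) :
  (forall n, a <= u n <= b) -> exists l : R, u @ U --> l.
Proof.
move=> ub; have ps : ProperFilter (u @ U) by apply: fmap_proper_filter; apply: ultra_proper.
have [l [_ cl]] : `[a, b]%classic `&` cluster (u @ U) !=set0.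
  apply: (segment_compact (a := a) (b := b)) => //.
  have : U (u @^-1` `[a, b]%classic) by apply: filterE => n /=; rewrite in_itv /= ub.
  exact.
exists l => V Vl; have [//|VC] := in_ultra_setVsetC (u @^-1` V) UU.
by have [x [/= nVx Vx]] := cl (~` V) V VC Vl.
Qed.

(** Limits are taken coordinatewise; total mass 1 survives because the alphabet is finite. *)
Lemma pmf_ultra_cvg (T : finType) (p : nat -> T -> R) : (forall n, is_pmf (p n)) ->
  exists q : T -> R, is_pmf q /\ forall t, (fun n => p n t) @ U --> q t.
Proof.
move=> Hp; have UP : ProperFilter U by apply: ultra_proper.
have /choice[q pq] : forall t, exists l : R, (fun n => p n t) @ U --> l.
  move=> t; apply: (@ultra_cvg_bounded _ 0 1) => n; have [p0 p1] := Hp n.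
  by rewrite p0 /= -p1 (bigD1 t) //= lerDl sumr_ge0.
exists q; split=> //; split=> [t|].
  apply: (cvgr_to_ge (pq t)); apply: nearW => n; by have [] := Hp n.
have h : (fun n => \sum_t p n t) @ U --> \sum_t q t by apply: cvg_sumr => t _; apply: pq.
have h1 : (fun n => \sum_t p n t) @ U --> (1 : R).
  by under eq_fun do rewrite (proj2 (Hp _)); apply: cvg_cst.
exact: (cvg_unique _ h h1).
Qed.

Lemma pmf_family_ultra_cvg K (T : finType) (p : nat -> 'I_K -> T -> R) :
  (forall n k, is_pmf (p n k)) ->
  exists q : 'I_K -> T -> R, (forall k, is_pmf (q k)) /\
    forall k t, (fun n => p n k t) @ U --> q k t.
Proof.
move=> Hp; have /choice[q qP] := fun k => pmf_ultra_cvg (fun n => Hp n k).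
by exists q; split=> k; have [] := qP k.
Qed.

Hypothesis ooU : \oo `<=` U.

(** After division by [n], the bit lost to rounding and the constant 1 of the converse are of order
    [1 / n] and vanish. *)
Lemma rate_limit (Rt D1 D2 A B : R) (e a b : nat -> R) (n1 n2 : nat -> nat) :
  0 <= Rt ->
  (forall n, (1 - e n) * log2 (msg_size Rt n)%:R - 1 <= (n1 n)%:R * a n + (n2 n)%:R * b n) ->
  e @ U --> (0 : R) -> a @ U --> A -> b @ U --> B ->
  (fun n => (n1 n)%:R / n%:R : R) @ U --> D1 ->
  (fun n => (n2 n)%:R / n%:R : R) @ U --> D2 ->
  Rt <= D1 * A + D2 * B.
Proof.
move=> Rt0 H e0 aA bB d1 d2; have UP : ProperFilter U by apply: ultra_proper.
have i0 : (fun n => n%:R^-1 : R) @ U --> (0 : R).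
  move=> V HV; apply: ooU.
  have : (fun n => n%:R^-1 : R) @ \oo --> (0 : R).
    by rewrite -cvg_shiftS; exact: cvg_harmonic.
  exact.
have L : (fun n => (1 - e n) * (Rt - n%:R^-1) - n%:R^-1) @ U --> (1 - 0) * (Rt - 0) - 0.
  apply: cvgB => //; apply: cvgM; apply: cvgB => //; exact: cvg_cst.
have G : (fun n => (n1 n)%:R / n%:R * a n + (n2 n)%:R / n%:R * b n) @ U --> D1 * A + D2 * B.
  by apply: cvgD; apply: cvgM.
rewrite !subr0 mul1r in L.
apply: (ler_cvg_to L G).
(* Eventually [1 - e n] is nonnegative, so multiplying by it preserves the lower bound on the
   message size. *)
have e1 : \forall n \near U, e n < 1 by apply: (cvgr_lt 0 e0).
have n0 : \forall n \near U, (0 < n)%N by apply: ooU; apply: nbhs_infty_gt.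
near=> n.
have en : 0 <= 1 - e n by rewrite subr_ge0 ltW //; near: n.
have nn : 0 < n%:R :> R by rewrite ltr0n; near: n.
rewrite -(ler_pM2r nn).
have -> : ((1 - e n) * (Rt - n%:R^-1) - n%:R^-1) * n%:R = (1 - e n) * (Rt * n%:R - 1) - 1.
  by field; rewrite gt_eqF.
have -> : ((n1 n)%:R / n%:R * a n + (n2 n)%:R / n%:R * b n) * n%:R =
    (n1 n)%:R * a n + (n2 n)%:R * b n.
  by field; rewrite gt_eqF.
apply: le_trans (H n); rewrite lerD2r ler_wpM2l //; exact: log2_msg_size_ge.
Unshelve. all: by end_near.
Qed.

End Limits.

(** * Signs of the two rates *)

Section Outer.
Context {R : realType} (m : nat) (Xa Xb Ya Yb : finType) (XR YR : 'I_m -> finType).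
Variable W2 : relvec XR -> Ya * Yb -> R.
Hypothesis HW2 : forall x, is_pmf (W2 x).
Hypothesis HXR : forall i, (0 < #|XR i|)%N.

(** At length 1 a message set is nonempty exactly when its rate is nonnegative, and each decoder
    maps a message of one set and some output to a message of the other. *)
Lemma rates_same_sign (Ra Rb : R)
    (C : mabc_code Xa Xb Ya Yb XR YR (msg_size Ra 1) (msg_size Rb 1) 1) :
  (0 <= Ra) = (0 <= Rb).
Proof.
(* The output alphabets are nonempty because a channel law has total mass 1. *)
have [ya yb] : Ya * Yb.
  have [_ W1s] := HW2 (relvec_inhabited HXR).
  case: (pickP (fun _ : Ya * Yb => true)) => [//|n0].
  by move: W1s; rewrite big_pred0 // => /eqP; rewrite eq_sym oner_eq0.
apply/idP/idP => H; apply: msg_size1_gt0; apply: leq_ltn_trans (leq0n _) (ltn_ord _).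
  exact: (@dec_a _ _ _ _ _ _ _ _ _ _ C (Ordinal (msg_size_gt0 1 H)) [ffun=> ya]).
exact: (@dec_b _ _ _ _ _ _ _ _ _ _ C (Ordinal (msg_size_gt0 1 H)) [ffun=> yb]).
Qed.

End Outer.

(** * Outer bound by passage to the limit *)

Theorem theorem7 (R : realType) (m : nat) (Xa Xb Ya Yb : finType)
    (XR YR : 'I_m -> finType)
    (W1 : Xa -> Xb -> relvec YR -> R) (W2 : relvec XR -> Ya * Yb -> R)
    (HXa : (0 < #|Xa|)%N) (HXb : (0 < #|Xb|)%N)
    (HXR : forall i : 'I_m, (0 < #|XR i|)%N)
    (HW1 : forall xa xb, is_pmf (W1 xa xb))
    (HW2 : forall xR, is_pmf (W2 xR))
    (D1 D2 Ra Rb : R) (HD1 : 0 <= D1) (HD2 : 0 <= D2) (HD : D1 + D2 = 1) :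
  achievable W1 W2 D1 D2 Ra Rb ->
  exists K : nat, (K <= 2 ^ m.+1)%N /\
  exists (pq : 'I_K -> R) (pa : 'I_K -> Xa -> R) (pb : 'I_K -> Xb -> R)
         (px : relvec XR -> R),
    [/\ is_pmf pq, (forall q, is_pmf (pa q)), (forall q, is_pmf (pb q)),
        is_pmf px &
    forall S : {set 'I_m},
      let P := outer_pmf W1 W2 pq pa pb px in
      Ra <= D1 * cmi P (@rvXa _ _ _ _ _ XR YR K)
                       (fun t => restr (~: S) (rvYR t))
                       (fun t => (rvXb t, rvQ t))
            + D2 * cmi P (fun t => restr S (rvXR t)) (@rvYb _ _ _ _ _ XR YR K)
                       (fun t => restr (~: S) (rvXR t)) /\
      Rb <= D1 * cmi P (@rvXb _ _ _ _ _ XR YR K)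
                       (fun t => restr (~: S) (rvYR t))
                       (fun t => (rvXa t, rvQ t))
            + D2 * cmi P (fun t => restr S (rvXR t)) (@rvYa _ _ _ _ _ XR YR K)
                       (fun t => restr (~: S) (rvXR t))].
Proof.
move=> [C [d1 d2 ea eb]]; exists (2 ^ m.+1)%N; split=> //.
have sgn := rates_same_sign HW2 HXR (C 1%N).
(* If one rate is negative, so is the other; point masses then make every right-hand side 0, which
   exceeds both rates. *)
have [Ra0|Ra0] := leP 0 Ra; last first.
  have Rb0 : Rb < 0 by rewrite ltNge -sgn -ltNge.
  have K0 : (0 < 2 ^ m.+1)%N by rewrite expn_gt0.
  have [/card_gt0P[xa _] /card_gt0P[xb _]] := (HXa, HXb).
  exists (fun q => (Ordinal K0 == q)%:R), (fun _ x => (xa == x)%:R),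
    (fun _ x => (xb == x)%:R), (fun x => (relvec_inhabited HXR == x)%:R).
  have := @delta_pmf R; split=> // S P.
  rewrite cmi_phase1_a // cmi_phase1_b // cmi_phase2_a // cmi_phase2_b //.
  rewrite !phase2_info_delta !mulr0 !addr0.
  rewrite !big1 ?mulr0 ?(ltW Ra0) ?(ltW Rb0) // => q _; by rewrite phase1_info_delta mulr0.
have Rb0 : 0 <= Rb by rewrite -sgn.
have cb n := code_bound HW1 HW2 HXa HXb HXR (C n) (msg_size_gt0 n Ra0) (msg_size_gt0 n Rb0).
have /choice[f fP] := cb.
have /choice[g gP] := fP.
have /choice[h hP] := gP.
have /choice[l lP] := hP.
(* One ultrafilter finer than [\oo] makes all the code-dependent laws converge at once, without
   successive subsequences. *)
have [U [UU ooU]] := ultraFilterLemma (eventually_filter).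
have [pq [Hpq pq_cvg]] := pmf_ultra_cvg UU (fun n => let: And5 H _ _ _ _ := lP n in H).
have [pa [Hpa pa_cvg]] := pmf_family_ultra_cvg UU (fun n => let: And5 _ H _ _ _ := lP n in H).
have [pb [Hpb pb_cvg]] := pmf_family_ultra_cvg UU (fun n => let: And5 _ _ H _ _ := lP n in H).
have [px [Hpx px_cvg]] := pmf_ultra_cvg UU (fun n => let: And5 _ _ _ H _ := lP n in H).
have UP : ProperFilter U by apply: ultra_proper.
exists pq, pa, pb, px; split=> // S P.
pose Pn n := outer_pmf W1 W2 (f n) (g n) (h n) (l n).
have Pn0 n t : 0 <= Pn n t by have [? ? ? ? _] := lP n; apply: outer_pmf_ge0.
have PnP t : ((fun n => Pn n t) @ U --> P t)%classic.
  case: t => [[[[[[q xa] xb] yR] xR] ya] yb] /=.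
  by repeat (apply: cvgM => //); apply: cvg_cst.
have sub (u : nat -> R) (x : R) : (u @ \oo --> x -> u @ U --> x)%classic.
  by move=> H V /H; apply: ooU.
have B n := let: And5 _ _ _ _ H := lP n in H S.
split.
  apply: (rate_limit UU ooU Ra0 (fun n => proj1 (B n)) (sub _ _ eb) _ _ (sub _ _ d1) (sub _ _ d2));
  exact: (cmi_cvg UP).
apply: (rate_limit UU ooU Rb0 (fun n => proj2 (B n)) (sub _ _ ea) _ _ (sub _ _ d1) (sub _ _ d2));
exact: (cmi_cvg UP).
Qed.
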